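(* Let $F$ be a finite group, $G=\mathbb{Z}\wr F$, and let $\mu$ be a probability measure on $G$ defining a standard simple switch-walk-switch random walk on $G$. Fix a word metric on $G$ (with respect to some finite generating set) and let $B(e,r)$ denote the ball of radius $r$ centered at the identity in this metric. Let $G_0=\sum_{\mathbb{Z}}F\subset G$. (1) [Almost invariance] For any $\epsilon>0$ there exist $c>0$ and subsets $V_n\subset G$ ($n\ge 1$) with $\mu^{*n}(V_n)\ge 1-\epsilon$ such that for any $n$, any $h\in V_n$ and any $g\in B(e,c\sqrt{n})$ $$\left|\frac{\mu^{*n}(hg)}{\mu^{*n}(h)}-1\right|\le\epsilon .$$ (2) [Invariance] For any $\epsilon>0$ there exist $c>0$ and subsets $V_n\subset G$ ($n\ge 1$) with $\mu^{*n}(V_n)\ge 1-\epsilon$ such that for any $n$, any $h\in V_n$ and any $g\in B(e,c\sqrt{n})\cap G_0$ $$\mu^{*n}(hg)=\mu^{*n}(h).$$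
   Context: The wreath product $A\wr B$ is the semidirect product of $A$ and $\sum_A B$ (the group of finitely supported functions $A\to B$ under pointwise multiplication), where $A$ acts on $\sum_A B$ by shifts. Elements are written $(a,f)$ with $a\in A$ and $f:A\to B$ finitely supported, with product $(a,f)(a',f')=(aa',\,f\cdot(a.f'))$, $(a.f')(x)=f'(a^{-1}x)$. $A$ is identified with the elements $(a,1)$, and $B$ with the elements $(e,f)$ with $f$ supported at $e_A$. $\mu^{*n}$ is the $n$-th convolution power of $\mu$. A measure $\mu$ on $\mathbb{Z}\wr F$ defines a standard simple switch-walk-switch random walk if $\mu=\mu_F*\mu_{\mathbb{Z}}*\mu_F$, where $\mu_{\mathbb{Z}}$ is a symmetric probability measure on $\mathbb{Z}$ whose support equals $\{-1,0,1\}$ and $\mu_F$ is the uniform distribution on $F$ (both viewed as measures on $\mathbb{Z}\wr F$ through the embeddings above). In (1), it is understood that the ratio is defined, i.e. $\mu^{*n}(h)>0$ for $h\in V_n$. *)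

(* Defs.v *)
From HB Require Import structures.
From mathcomp Require Import all_boot all_order all_algebra all_fingroup.
From mathcomp Require Import finmap.
From mathcomp Require Import all_classical all_reals all_analysis.

Set Implicit Arguments.
Unset Strict Implicit.
Unset Printing Implicit Defensive.

Import Order.TTheory GRing.Theory Num.Theory GroupScope.

Local Open Scope fset_scope.
Local Open Scope classical_set_scope.
Local Open Scope ring_scope.

Record wreath (A B : groupType) := Wreath {
  cursor : A;
  lamps : {fsfun A -> B with 1%g} }.

Section WreathGroup.
Variables A B : groupType.
Implicit Types (a x : A) (f : {fsfun A -> B with 1%g}) (g h : wreath A B).

Definition pair_of_wreath g := (cursor g, lamps g).
Definition wreath_of_pair (p : A * {fsfun A -> B with 1%g}) :=
  Wreath p.1 p.2.

Lemma pair_of_wreathK : cancel pair_of_wreath wreath_of_pair.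
Proof. by case. Qed.

HB.instance Definition _ :=
  Choice.copy (wreath A B) (can_type pair_of_wreathK).

Definition fsmul f1 f2 : {fsfun A -> B with 1%g} :=
  [fsfun x in (finsupp f1 `|` finsupp f2)%fset => (f1 x * f2 x)%g | 1%g].

Definition fsinv f : {fsfun A -> B with 1%g} :=
  [fsfun x in finsupp f => (f x)^-1%g | 1%g].

Definition wshift a f : {fsfun A -> B with 1%g} :=
  [fsfun x in [fset (a * y)%g | y in finsupp f] => f (a^-1 * x)%g | 1%g].

Lemma fsmulE f1 f2 x : fsmul f1 f2 x = (f1 x * f2 x)%g.
Proof.
rewrite fsfunE inE; case: (finsuppP f1 x) => //= _.
by case: (finsuppP f2 x); rewrite ?mulg1.
Qed.

Lemma fsinvE f x : fsinv f x = (f x)^-1%g.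
Proof. by rewrite fsfunE; case: finsuppP; rewrite ?invg1. Qed.

Lemma wshiftE a f x : wshift a f x = f (a^-1 * x)%g.
Proof.
rewrite fsfunE; case: ifPn => // /negP xNaf.
case: (finsuppP f (a^-1 * x)%g) => // fx; case: xNaf.
by apply/imfsetP; exists (a^-1 * x)%g => //; rewrite mulVKg.
Qed.

Definition wone : wreath A B := Wreath 1%g [fsfun with 1%g].

Definition wmul g h : wreath A B :=
  Wreath (cursor g * cursor h)%g (fsmul (lamps g) (wshift (cursor g) (lamps h))).

Definition winv g : wreath A B :=
  Wreath (cursor g)^-1%g (wshift (cursor g)^-1%g (fsinv (lamps g))).

Lemma wreath_eq g h : cursor g = cursor h -> lamps g =1 lamps h -> g = h.
Proof. by case: g h => [a f] [b f'] /= -> /fsfunP ->. Qed.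

Lemma wmulA : associative wmul.
Proof.
move=> g h k; apply: wreath_eq => [|x] /=; first by rewrite mulgA.
by rewrite !(fsmulE, wshiftE) invgM !mulgA.
Qed.

Lemma wmul1g : left_id wone wmul.
Proof.
move=> g; apply: wreath_eq => [|x] /=; first by rewrite mul1g.
by rewrite fsmulE wshiftE fsfun0E invg1 !mul1g.
Qed.

Lemma wmulg1 : right_id wone wmul.
Proof.
move=> g; apply: wreath_eq => [|x] /=; first by rewrite mulg1.
by rewrite fsmulE wshiftE fsfun0E mulg1.
Qed.

Lemma wmulVg : left_inverse wone winv wmul.
Proof.
move=> g; apply: wreath_eq => [|x] /=; first by rewrite mulVg.
by rewrite fsmulE !wshiftE fsinvE fsfun0E mulVg.
Qed.

Lemma wmulgV : right_inverse wone winv wmul.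
Proof.
move=> g; apply: wreath_eq => [|x] /=; first by rewrite mulgV.
by rewrite fsmulE !wshiftE fsinvE fsfun0E invgK mulVKg mulgV.
Qed.

HB.instance Definition _ :=
  isGroup.Build (wreath A B) wmulA wmul1g wmulg1 wmulVg wmulgV.

Definition inj_cursor a : wreath A B := Wreath a [fsfun with 1%g].

Definition inj_lamp (b : B) : wreath A B :=
  Wreath 1%g [fsfun x in [fset (1%g : A)] => b | 1%g].

Definition lamp_subgroup : set (wreath A B) := [set g | cursor g = 1%g].

End WreathGroup.

(* A measure on a discrete set is given by its mass function. The sums below
   are < +oo for probability measures, so that fine loses nothing. *)
Section Mass.
Variable R : realType.

Definition mass (T : choiceType) (mu : T -> R) (X : set T) : \bar R :=
  (\esum_(x in X) (mu x)%:E)%E.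

Definition is_prob (T : choiceType) (mu : T -> R) : Prop :=
  (forall x, 0 <= mu x) /\ mass mu [set: T] = 1%E.

Definition push (T U : choiceType) (phi : T -> U) (mu : T -> R) : U -> R :=
  fun u => fine (mass mu (phi @^-1` [set u])).

Definition unif_mass (F : finGroupType) : F -> R := fun=> #|F|%:R^-1.

Definition convol (G : groupType) (mu nu : G -> R) : G -> R :=
  fun g => fine (\esum_(h in [set: G]) (mu h * nu (h^-1 * g)%g)%:E)%E.

Fixpoint convol_pow (G : groupType) (mu : G -> R) (n : nat) : G -> R :=
  if n is m.+1 then convol mu (convol_pow mu m) else fun g => (g == 1%g)%:R.

End Mass.

Section WordMetric.
Variables (R : realType) (G : groupType) (S : set G).

(* S need not be symmetric: a letter is an element of S or the inverse of one. *)
Definition words (g : G) : set (seq G) :=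
  [set w | (forall s, s \in w -> S s \/ S s^-1%g) /\ (\prod_(s <- w) s)%g = g].

Definition generates : Prop := forall g, words g !=set0.

Definition word_dist (g h : G) : \bar R :=
  ereal_inf [set (size w)%:R%:E | w in words (g^-1 * h)%g].

Definition word_ball (g : G) (r : R) : set G :=
  [set h | (word_dist g h <= r%:E)%E].

End WordMetric.

(* The product, unit and inverse of Zgrp are +, 0 and - on int. *)
Definition Zgrp : groupType := Algebra.to_multiplicative int.

Definition switch_walk_switch (R : realType) (F : finGroupType)
    (mu : wreath Zgrp F -> R) : Prop :=
  exists muZ : int -> R,
    [/\ is_prob muZ,
        (forall k, muZ (- k) = muZ k),
        [set k | muZ k != 0] = [set -1; 0; 1] &
        let muF := push (@inj_lamp Zgrp F) (@unif_mass R F) in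
        mu = convol (convol muF (push (@inj_cursor Zgrp F) muZ)) muF].

(* Main.v *)
Require Import Defs.
From mathcomp Require Import all_boot all_order all_algebra all_fingroup.
From mathcomp Require Import finmap.
From mathcomp Require Import all_classical all_reals all_analysis.
From mathcomp Require Import lra zify.

Set Implicit Arguments.
Unset Strict Implicit.
Unset Printing Implicit Defensive.

Import Order.TTheory GRing.Theory Num.Theory.

Local Open Scope classical_set_scope.
Local Open Scope ring_scope.

(** Why the theorem is true.  Write [mu^n] for the [n]-th convolution power of
    [mu], and [(x, f)] for the element of the group with cursor [x] and lamp
    configuration [f].

    Every step of the walk refreshes the lamps at both ends of the move, so
    after [n >= 1] steps the lamps over the interval visited by the cursor are
    independent and uniform, and all the others are off.  Therefore [mu^n] is a
    combination of indicators of sets of the form: the cursor is at [x], and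
    every lit lamp lies in [[a, b]] (with [a <= x <= b]).  This is [cone_law].
    The value of such an indicator depends on [f] through its outermost lit
    lamps only, so altering lamps strictly between two lit ones does not change
    [mu^n (x, f)] ([cone_hull], [law_flanked]).  This has two consequences.

    Invariance.  An element [g] of length at most [c * sqrt n] moves the cursor
    by at most [k = O(c * sqrt n)] and acts on lamps within distance [k] of the
    cursor.  If [h] has lit lamps farther than [k] from its cursor on both
    sides, then [mu^n (h g)] is the value of [mu^n] at [h] with its cursor
    shifted, and it is [mu^n h] when [g] does not shift the cursor.  Unless
    [F] is trivial, the probability that no lamp is lit farther than [K] to a
    given side of the cursor is [O(K / sqrt n)] by [law_tail]: as a function
    of [K] this probability satisfies a discrete heat equation which is damped
    at [0], so it is dominated by the solution [sgn_heat] issued from the sign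
    function, and [sgn_heat] is controlled by its slope at [0], which is
    [O(1 / sqrt n)] ([sgn_heat_1]).

    Almost invariance.  As long as the cursor stays strictly between two lit
    lamps, [mu^n] solves the heat equation in the position of the cursor
    ([law_caloric]).  A solution which is bounded by [1] on an interval of
    radius [K] has gradient [O(1 / sqrt n + 1 / K)] at the centre
    ([caloric_gradient]); this too follows by comparison with [sgn_heat].
    Testing [mu^n] against signs turns the pointwise estimate into a bound in
    [l^1]: a unit shift of the cursor changes [mu^n], summed over the
    configurations which have lit lamps beyond distance [K] on both sides, by
    [O(1 / sqrt n + 1 / K)] ([law_gradient]).  With [K] of order [sqrt n], the
    variation of [mu^n] over all shifts by at most [c * sqrt n] then has total
    mass [O(c)], and by Markov's inequality it is at most [eps * mu^n h] for
    all [h] outside a set of small [mu^n]-measure ([typical_set]).  When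
    [c * sqrt n < 1] the ball contains only the identity. *)

(** * The heat equation on the integers *)

Section Heat.
Variables (R : realType) (p : R).
Hypotheses (p_gt0 : 0 < p) (p_lt : 2 * p < 1).

Definition heat (phi : int -> R) : int -> R :=
  fun x => (1 - 2 * p) * phi x + p * (phi (x + 1) + phi (x - 1)).

(** Odd functions replace the Dirichlet problem on the half-line: the
    equation on all integers keeps an odd function odd, so the boundary value
    at [0] needs no separate treatment. *)
Definition oddf (phi : int -> R) := forall x, phi (- x) = - phi x.

Lemma oddf0 phi : oddf phi -> phi 0 = 0.
Proof. by move=> /(_ 0); rewrite oppr0; lra. Qed.

Lemma heat_odd phi : oddf phi -> oddf (heat phi).
Proof.
move=> phiN x; rewrite /heat.
have -> : - x + 1 = - (x - 1) by lra.
have -> : - x - 1 = - (x + 1) by lra.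
by rewrite !phiN; lra.
Qed.

(** The maximum principle on the half-line.  At [x >= 1] all three weights of
    [heat] are nonnegative and the left neighbour [x - 1] is still in the
    half-line; this is why odd symmetry about an integer is used, and not
    about a half-integer, where the principle fails for [p > 1 / 3]. *)
Lemma heat_odd_ge0 phi : oddf phi -> (forall x : int, 0 <= x -> 0 <= phi x) ->
  forall x : int, 0 <= x -> 0 <= heat phi x.
Proof.
move=> phiN phi_ge0 x x_ge0.
have [-> | x_neq0] := eqVneq x 0; first by rewrite (oddf0 (heat_odd phiN)).
have x_gt0 : 0 < x by rewrite lt_def x_neq0.
have x1_ge0 : 0 <= x + 1 by lia.
have x2_ge0 : 0 <= x - 1 by lia.
have := phi_ge0 x x_ge0; have := phi_ge0 _ x1_ge0; have := phi_ge0 _ x2_ge0.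
have p'_ge0 : 0 <= 1 - 2 * p by rewrite subr_ge0 ltW.
by rewrite /heat => *; rewrite addr_ge0// mulr_ge0// ?addr_ge0// ltW.
Qed.

(** For [x >= 0], the probability that the lazy walk started at [x] has not hit
    [0] by time [n]. *)
Definition sgn_heat n : int -> R := iter n heat (fun x => (sgz x)%:~R).

Lemma sgn_heatS n x : sgn_heat n.+1 x =
  (1 - 2 * p) * sgn_heat n x + p * (sgn_heat n (x + 1) + sgn_heat n (x - 1)).
Proof. by []. Qed.

Lemma sgn_heat_odd n : oddf (sgn_heat n).
Proof.
elim: n => [x|n IH] /=; last exact: heat_odd.
by rewrite /sgn_heat /= sgzN rmorphN.
Qed.

Lemma sgn_heat_0 n : sgn_heat n 0 = 0.
Proof. exact: oddf0 (sgn_heat_odd n). Qed.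

Lemma sgn_heat_ge0 n (x : int) : 0 <= x -> 0 <= sgn_heat n x.
Proof.
elim: n x => [|n IH] x; first by rewrite /sgn_heat /= ler0z sgz_ge0.
exact: heat_odd_ge0 (sgn_heat_odd n) IH x.
Qed.

(** Minus the second difference of [sgn_heat] is odd, solves the heat equation,
    and is nonnegative on the half-line at time [0]. *)
Lemma sgn_heat_concave n (x : int) : 0 <= x ->
  sgn_heat n (x + 1) + sgn_heat n (x - 1) <= 2 * sgn_heat n x.
Proof.
move=> x_ge0; rewrite -subr_ge0.
pose c n (x : int) :=
  2 * sgn_heat n x - (sgn_heat n (x + 1) + sgn_heat n (x - 1)).
have c_odd m : oddf (c m).
  move=> y; rewrite /c.
  have -> : - y + 1 = - (y - 1) by lra.
  have -> : - y - 1 = - (y + 1) by lra.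
  by rewrite !sgn_heat_odd; lra.
suff: forall y : int, 0 <= y -> 0 <= c n y by apply.
elim: n {x x_ge0} => [|n IH] x x_ge0.
  rewrite /c /sgn_heat /=; have [-> | x_neq0] := eqVneq x 0.
    by rewrite add0r sub0r sgz0 sgz1 sgzN1; lra.
  have x_gt0 : 0 < x by rewrite lt_def x_neq0.
  have -> : sgz x = 1 by apply: gtr0_sgz.
  have -> : sgz (x + 1) = 1 by apply: gtr0_sgz; lia.
  have : sgz (x - 1) <= 1 by case: sgzP.
  by rewrite -(ler_int R); lra.
have -> : c n.+1 x = heat (c n) x.
  rewrite /c !sgn_heatS /heat.
  have -> : x + 1 - 1 = x by lra.
  have -> : x - 1 + 1 = x by lra.
  by lra.
exact: heat_odd_ge0 (c_odd n) IH x x_ge0.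
Qed.

Lemma sgn_heat_decr m n (x : int) : (m <= n)%N -> 0 <= x ->
  sgn_heat n x <= sgn_heat m x.
Proof.
move=> lemn x_ge0; elim: n lemn => [|n IH]; first by rewrite leqn0 => /eqP->.
rewrite leq_eqVlt => /predU1P[<-//|] /IH; apply: le_trans.
rewrite sgn_heatS; have := sgn_heat_concave n x_ge0; have := p_gt0; nra.
Qed.

Lemma sgn_heat_linear n (k : nat) : sgn_heat n k%:Z <= k%:R * sgn_heat n 1.
Proof.
have step (j : nat) : sgn_heat n j.+1%:Z - sgn_heat n j%:Z <= sgn_heat n 1.
  elim: j => [|j IH]; first by rewrite sgn_heat_0 subr0.
  have := sgn_heat_concave n (isT : 0 <= j.+1%:Z).
  have -> : j.+1%:Z - 1 = j by lia.
  have -> : j.+1%:Z + 1 = j.+2%:Z by lia.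
  by move: IH; lra.
elim: k => [|k IH]; first by rewrite mul0r sgn_heat_0.
by have := step k; rewrite -[k.+1%:R]natr1 mulrDl mul1r; lra.
Qed.

(** The expected distance to [0] at time [n] of the lazy walk started at [x]. *)
Definition abs_heat n : int -> R := iter n heat (fun x => `|x|%:~R).

Lemma abs_heatS n x : abs_heat n.+1 x = heat (abs_heat n) x.
Proof. by []. Qed.

Lemma abs_heat_even n x : abs_heat n (- x) = abs_heat n x.
Proof.
elim: n x => [|n IH] x; first by rewrite /abs_heat /= normrN.
rewrite !abs_heatS /heat.
have -> : - x + 1 = - (x - 1) by lra.
have -> : - x - 1 = - (x + 1) by lra.
by rewrite !IH; lra.
Qed.

Lemma abs_heat_diff n x :
  abs_heat n (x + 1) - abs_heat n (x - 1) = 2 * sgn_heat n x.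
Proof.
elim: n x => [|n IH] x.
  rewrite /abs_heat /sgn_heat /= -intrB -[2]/(2%:~R) -intrM; congr (_%:~R).
  by case: sgzP => ?; lia.
rewrite !abs_heatS sgn_heatS /heat.
have := IH (x + 1); have := IH x; have := IH (x - 1).
have -> : x + 1 - 1 = x by lra.
have -> : x - 1 + 1 = x by lra.
move=> h1 h2 h3.
have := congr1 ( *%R p) h1; have := congr1 ( *%R (1 - 2 * p)) h2.
by have := congr1 ( *%R p) h3; lra.
Qed.

(** Growth rate of [abs_heat]: as the discrete Laplacian of the absolute value
    is [2] at the origin and [0] elsewhere, one step increases
    [abs_heat m 0 + abs_heat m 1] by exactly [2 * p * sgn_heat m 1], and these
    increments decrease with [m]. *)
Lemma abs_heat_growth m n : (m <= n)%N ->
  2 * p * m%:R * sgn_heat n 1 <= abs_heat m 0 + abs_heat m 1 - 1.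
Proof.
elim: m => [|m IH] mn.
  by rewrite mulr0 mul0r /abs_heat /= normr0 normr1; lra.
have := IH (ltnW mn); rewrite !abs_heatS /heat -[m.+1%:R]natr1.
have := abs_heat_even m 1; rewrite add0r sub0r subrr => ->.
have := abs_heat_diff m 1; rewrite subrr => hdiff IHm.
have := sgn_heat_decr (ltnW mn) (isT : 0 <= 1 :> int).
move=> /(ler_wpM2l (ltW p_gt0)).
have := congr1 ( *%R p) hdiff; move: IHm; lra.
Qed.

(** The bound of the first moment by the second, [x ^+ 2 + 2 * p * m], in the
    form of the inequality [2 * |y| <= l + y ^+ 2 / l], which the heat equation
    preserves. *)
Lemma abs_heat_le m (l : R) x : 0 < l ->
  abs_heat m x <= 2^-1 * (l + ((x%:~R) ^+ 2 + 2 * p * m%:R) / l).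
Proof.
move=> l_gt0; elim: m x => [|m IH] x.
  rewrite mulr0 addr0 /abs_heat /= intr_norm.
  set y : R := Num.norm _.
  have -> : (x%:~R : R) ^+ 2 = y ^+ 2 by rewrite real_normK ?num_real.
  rewrite -subr_ge0.
  have -> : 2^-1 * (l + y ^+ 2 / l) - y = 2^-1 / l * (l - y) ^+ 2.
    have h z : l * l^-1 * z = z by rewrite mulfV ?mul1r// gt_eqF.
    by have := h l; have := h y; lra.
  by rewrite mulr_ge0 ?sqr_ge0// mulr_ge0 ?invr_ge0 ?ltW.
rewrite abs_heatS /heat; have := IH x; have := IH (x + 1); have := IH (x - 1).
rewrite intrB intrD -[1%:~R]/(1:R) -[m.+1%:R]natr1.
set a := abs_heat m _; set b := abs_heat m _; set c := abs_heat m _.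
set y := x%:~R; move=> ha hb hc.
have -> : 2^-1 * (l + (y ^+ 2 + 2 * p * (m%:R + 1)) / l) =
  (1 - 2 * p) * (2^-1 * (l + (y ^+ 2 + 2 * p * m%:R) / l)) +
  p * (2^-1 * (l + ((y + 1) ^+ 2 + 2 * p * m%:R) / l) +
       2^-1 * (l + ((y - 1) ^+ 2 + 2 * p * m%:R) / l)).
  by lra.
by rewrite lerD ?ler_wpM2l ?lerD ?subr_ge0 ?(ltW p_gt0) ?(ltW p_lt).
Qed.

(** The expected distances are [O(sqrt n)] by [abs_heat_le], applied with
    [l = sqrt n], and they dominate [n * sgn_heat n 1] by
    [abs_heat_growth]. *)
Lemma sgn_heat_1 n : sgn_heat n.+1 1 * Num.sqrt n.+1%:R <= 3 / (2 * p).
Proof.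
have := abs_heat_growth (leqnn n.+1).
set q := Num.sqrt _; have q_gt0 : 0 < q by rewrite sqrtr_gt0.
have q2 : n.+1%:R = q ^+ 2 by rewrite sqr_sqrtr.
have := abs_heat_le n.+1 1 q_gt0; have := abs_heat_le n.+1 0 q_gt0.
have q_ge1 : 1 <= q by rewrite -(sqrtr1 R) ler_sqrt ?ler1n.
rewrite !q2 -[0%:~R]/(0:R) -[1%:~R]/(1:R) expr0n add0r expr1n.
have -> : 2 * p * q ^+ 2 / q = 2 * p * q by rewrite expr2 mulrA mulfK// gt_eqF.
have -> : (1 + 2 * p * q ^+ 2) / q = q^-1 + 2 * p * q.
  by rewrite mulrDl mul1r expr2 mulrA mulfK// gt_eqF.
have : q^-1 <= 1 by rewrite invf_le1.
set s := sgn_heat _ _; set t0 := abs_heat _ _; set t1 := abs_heat _ _.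
move=> h1 h2 h3 h4.
rewrite ler_pdivlMr ?mulr_gt0//.
have [p0 p1] := (p_gt0, p_lt).
have h : (s * q * (2 * p)) * q <= 3 * q.
  have -> : s * q * (2 * p) * q = 2 * p * q ^+ 2 * s by lra.
  by nra.
by rewrite -(ler_pM2r q_gt0).
Qed.

Section Caloric.
Variables (H : nat -> int -> R) (K : nat).
Hypothesis K_gt0 : (0 < K)%N.
Hypothesis H_le1 : forall n (y : int), `|y| <= K%:Z -> `|H n y| <= 1.
Hypothesis H_heat : forall n (y : int), `|y| < K%:Z -> H n.+1 y = heat (H n) y.

(** The difference between [H] and its mirror image is odd and solves the heat
    equation for [|y| < K].  Both terms on the right solve it too; the first
    one dominates at time [0], the second one at the lateral boundary
    [y = K]. *)
Lemma caloric_mirror n (y : int) : 0 <= y <= K%:Z ->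
  `|H n y - H n (- y)| <= 2 * sgn_heat n y + 2 * y%:~R / K%:R.
Proof.
have K0 : 0 < K%:R :> R by rewrite ltr0n.
have le2 m (x : int) : `|x| <= K%:Z -> `|H m x - H m (- x)| <= 2.
  move=> xK; apply: le_trans (ler_normB _ _) _.
  by rewrite -[2]/(1 + 1 : R) lerD ?H_le1// normrN.
elim: n y => [|n IH] y /andP[y_ge0 yK].
all: have [-> | y_neq0] := eqVneq y 0;
  first by rewrite oppr0 subrr normr0 sgn_heat_0 !(mulr0, mul0r) addr0.
  apply: le_trans (le2 _ _ _) _; first by rewrite ger0_norm.
  rewrite /sgn_heat /= gtr0_sgz ?lt_def ?y_neq0// mulr1 lerDl.
  by rewrite divr_ge0 ?mulr_ge0 ?ler0z.
have [yltK|] := ltP y K%:Z; last first.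
  move=> KY; have -> : y = K%:Z by lia.
  apply: le_trans (le2 _ _ _) _; first by rewrite ger0_norm.
  by rewrite mulfK ?gt_eqF// lerDr mulr_ge0// sgn_heat_ge0.
have yK' : `|y| < K%:Z by rewrite ger0_norm.
rewrite !H_heat ?normrN// sgn_heatS /heat.
have y_gt0 : 0 < y by rewrite lt_def y_neq0.
have h1 := IH y ltac:(lia); have h2 := IH (y + 1) ltac:(lia).
have h3 := IH (y - 1) ltac:(lia).
have -> : - y + 1 = - (y - 1) by lra.
have -> : - y - 1 = - (y + 1) by lra.
set a := H n y in h1 *; set a' := H n (- y) in h1 *.
set b := H n (y + 1) in h2 *; set b' := H n (- (y + 1)) in h2 *.
set c := H n (y - 1) in h3 *; set c' := H n (- (y - 1)) in h3 *.
have -> : (1 - 2 * p) * a + p * (b + c) - ((1 - 2 * p) * a' + p * (c' + b')) =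
  (1 - 2 * p) * (a - a') + (p * (b - b') + p * (c - c')) by lra.
apply: le_trans (ler_normD _ _) _.
apply: le_trans (lerD (lexx _) (ler_normD _ _)) _.
have p'_gt0 : 0 < 1 - 2 * p by rewrite subr_gt0.
rewrite !normrM (gtr0_norm p'_gt0) (gtr0_norm p_gt0).
have -> : 2 * ((1 - 2 * p) * sgn_heat n y +
    p * (sgn_heat n (y + 1) + sgn_heat n (y - 1))) + 2 * y%:~R / K%:R =
  (1 - 2 * p) * (2 * sgn_heat n y + 2 * y%:~R / K%:R) +
  (p * (2 * sgn_heat n (y + 1) + 2 * (y + 1)%:~R / K%:R) +
   p * (2 * sgn_heat n (y - 1) + 2 * (y - 1)%:~R / K%:R)).
  by rewrite intrB intrD -[1%:~R]/(1:R); lra.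
by rewrite lerD ?ler_wpM2l ?lerD ?ler_wpM2l ?subr_ge0 ?(ltW p_gt0) ?(ltW p_lt).
Qed.

End Caloric.

Lemma half_bounds n : (1 < n)%N ->
  [/\ n = (n./2 + (n - n./2))%N, (0 < n./2)%N, (n.+1 <= 4 * n./2)%N &
      (n.+1 <= 4 * (n - n./2))%N].
Proof. by move=> n_gt1; split; lia. Qed.

Lemma leq_double_pred K : (1 < K)%N -> (K <= 2 * K.-1)%N.
Proof. by lia. Qed.

(** The sum of the geometric series bounds [j] times its [j]-th term. *)
Lemma expr_geom_le (r : R) j : 0 <= r < 1 -> r ^+ j * j%:R <= (1 - r)^-1.
Proof.
move=> /andP[r0 r1].
have : (1 - r) * (r ^+ j * j%:R) <= 1 - r ^+ j.
  elim: j => [|j IH]; first by rewrite mulr0 mulr0 expr0 subrr.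
  have := exprn_ge0 j r0; rewrite exprS -natr1; move: IH.
  have : r ^+ j <= 1 by rewrite exprn_ile1// ltW.
  set u := r ^+ j; set v := j%:R => u1 IH u0.
  have -> : (1 - r) * (r * u * (v + 1)) =
    r * ((1 - r) * (u * v)) + r * (u * (1 - r)) by lra.
  have := ler_wpM2l r0 IH.
  have : 0 <= (1 - r) * (1 - r * u).
    by rewrite mulr_ge0 ?subr_ge0 ?(ltW r1) ?mulr_ile1 ?(ltW r1).
  nra.
have := exprn_ge0 j r0 => u0 h.
by rewrite -[leRHS]mul1r ler_pdivlMr ?subr_gt0// mulrC; lra.
Qed.

(** [caloric_mirror] controls differences over two units, [e n x].  The
    difference [d n] over one unit satisfies the recursion
    [d n.+1 = (1 - 4 * p) * d n + p * (e n 1 + e n 0)], whose factor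
    [1 - 4 * p] has absolute value less than [1]: started at time [n / 2], when
    the [e] are already as small as they should be, it forgets its initial
    value geometrically fast. *)
Lemma caloric_gradient : exists2 C : R, 0 < C &
  forall (H : nat -> int -> R) (K : nat), (1 < K)%N ->
  (forall n (y : int), `|y| <= K%:Z -> `|H n y| <= 1) ->
  (forall n (y : int), `|y| < K%:Z -> H n.+1 y = heat (H n) y) ->
  forall n, `|H n 1 - H n 0| <= C / Num.sqrt n.+1%:R + C / K%:R.
Proof.
pose rho : R := `|1 - 4 * p|.
have [p0 p1] := (p_gt0, p_lt).
have rho_lt1 : rho < 1 by rewrite ltr_norml; apply/andP; split; lra.
have rho01 : 0 <= rho < 1 by rewrite normr_ge0.
have r1_gt0 : 0 < (1 - rho)^-1 by rewrite invr_gt0 subr_gt0.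
exists (20 / (1 - rho)); first by rewrite mulr_gt0.
move=> H K K_gt1 H_le1 H_heat.
have K_gt0 : 0 < K%:R :> R by rewrite ltr0n ltnW.
have K1_gt0 : 0 < K.-1%:R :> R by rewrite ltr0n; lia.
pose d n := H n 1 - H n 0.
pose e n (x : int) := H n (x + 1) - H n (x - 1).
pose E n : R := 2 * sgn_heat n 1 + 2 / K.-1%:R.
have e_le n (x : int) : `|x| <= 1 -> `|e n x| <= E n.
  move=> x1; have := @caloric_mirror (fun n y => H n (y + x)) K.-1.
  move=> /(_ ltac:(lia)) /(_ _ _ n 1 ltac:(lia)) h.
  move: h; rewrite -[1%:~R]/(1 : R) mulr1 [1 + x]addrC [- 1 + x]addrC.
  apply => [m y yK|m y yK]; first by apply: H_le1; lia.
  rewrite H_heat; last by lia.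
  rewrite /heat.
  have -> : y + x + 1 = y + 1 + x by lra.
  by have -> : y + x - 1 = y - 1 + x by lra.
have dS n : `|d n.+1| <= rho * `|d n| + 2 * p * E n.
  rewrite /d !H_heat ?normr0; [|lia..].
  rewrite /heat add0r sub0r subrr.
  have h0 := e_le n 0 ltac:(lia); have h1 := e_le n 1 ltac:(lia).
  have -> : (1 - 2 * p) * H n 1 + p * (H n (1 + 1) + H n 0) -
     ((1 - 2 * p) * H n 0 + p * (H n 1 + H n (- 1))) =
     (1 - 4 * p) * (H n 1 - H n 0) + p * (e n 1 + e n 0).
    by rewrite /e subrr add0r sub0r; lra.
  apply: le_trans (ler_normD _ _) _; rewrite normrM lerD// normrM gtr0_norm//.
  rewrite [2 * p]mulrC -mulrA ler_wpM2l ?(ltW p0)//.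
  by apply: le_trans (ler_normD _ _) _; lra.
have E_ge0 n : 0 <= E n.
  by rewrite addr_ge0 ?mulr_ge0 ?sgn_heat_ge0 ?invr_ge0 ?(ltW K1_gt0).
have d_le2 n : `|d n| <= 2.
  apply: le_trans (ler_normB _ _) _.
  by rewrite -[2]/(1 + 1 : R) lerD ?H_le1 ?normr0//; lia.
have d_iter m j : `|d (m + j)%N| <= 2 * rho ^+ j + 2 * p * E m / (1 - rho).
  elim: j => [|j IH].
    rewrite addn0 expr0 mulr1; apply: le_trans (d_le2 m) _.
    by rewrite lerDl divr_ge0 ?subr_ge0 ?mulr_ge0 ?(ltW p0) ?(ltW rho_lt1).
  rewrite addnS; apply: le_trans (dS _) _.
  have hE : E (m + j)%N <= E m.
    by rewrite lerD2r ler_wpM2l// sgn_heat_decr// leq_addr.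
  have r0 : 0 <= rho by rewrite normr_ge0.
  have -> : 2 * rho ^+ j.+1 + 2 * p * E m / (1 - rho) =
    rho * (2 * rho ^+ j + 2 * p * E m / (1 - rho)) + 2 * p * E m.
    have := mulfVK (_ : 1 - rho != 0) (2 * p * E m).
    rewrite subr_eq0 gt_eqF// => /(_ isT); rewrite exprS; lra.
  by rewrite lerD ?ler_wpM2l// mulr_ge0// ltW.
move=> n; rewrite -/(d n).
have s_gt0 : 0 < Num.sqrt n.+1%:R :> R by rewrite sqrtr_gt0.
have r1_ge1 : 1 <= (1 - rho)^-1.
  by rewrite invf_ge1 ?subr_gt0// gerBl normr_ge0.
have K2 : 0 <= 20 / (1 - rho) / K%:R.
  by rewrite !mulr_ge0 ?invr_ge0 ?(ltW K_gt0) ?subr_ge0 ?(ltW rho_lt1).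
have [n_le1|n_gt1] := leqP n 1.
  apply: le_trans (d_le2 n) _; rewrite -[leLHS]addr0 lerD// ler_pdivlMr//.
  apply: (@le_trans _ _ (2 * 2)); last by lra.
  rewrite ler_wpM2l// -[2 in leRHS]gtr0_norm// -sqrtr_sqr ler_sqrt//.
    by rewrite -natrX ler_nat ltnS (leq_trans n_le1).
pose m := n./2; pose j := (n - m)%N.
have [nE m_gt0 n4m n4j] := half_bounds n_gt1.
rewrite {1}nE; apply: le_trans (d_iter m j) _.
set s := Num.sqrt _ in s_gt0 *.
have s2 : n.+1%:R = s ^+ 2 by rewrite sqr_sqrtr.
have s_ge1 : 1 <= s by rewrite -(sqrtr1 R) ler_sqrt ?ler1n.
have hj : rho ^+ j * s <= 4 / (1 - rho).
  have := expr_geom_le j rho01.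
  have : 0 <= rho ^+ j by rewrite exprn_ge0// normr_ge0.
  have : s ^+ 2 <= 4 * j%:R by rewrite -s2 -natrM ler_nat.
  nra.
have hm : 2 * p * sgn_heat m 1 * s <= 6.
  have := sgn_heat_1 m.-1; rewrite prednK// ler_pdivlMr ?mulr_gt0//.
  have : s <= 2 * Num.sqrt m%:R.
    rewrite -[2]gtr0_norm// -sqrtr_sqr -sqrtrM ?exprn_ge0//.
    have -> : 2 ^+ 2 * m%:R = (4 * m)%:R :> R by rewrite natrM -natrX.
    by rewrite ler_sqrt ?ler0n// ler_nat.
  have : 0 <= sgn_heat m 1 by rewrite sgn_heat_ge0.
  set a := sgn_heat m 1; set b := Num.sqrt _ => a0 h1 h2.
  have := ler_wpM2l (mulr_ge0 (ltW p0) a0) h1; move: h2; lra.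
have hK : K%:R <= 2 * K.-1%:R :> R by rewrite -natrM ler_nat leq_double_pred.
have -> : 2 * rho ^+ j + 2 * p * E m / (1 - rho) =
  2 * (rho ^+ j * s) / s + 2 * (2 * p * sgn_heat m 1 * s) / (1 - rho) / s +
  4 * p / K.-1%:R / (1 - rho).
  have sK x : x * s / s = x by rewrite mulfK ?gt_eqF.
  have := sK (rho ^+ j); have := sK (2 * p * sgn_heat m 1 * (1 - rho)^-1).
  by rewrite /E; lra.
apply: lerD.
  rewrite -mulrDl ler_wpM2r ?invr_ge0 ?(ltW s_gt0)//.
  by have := ler_wpM2r (ltW r1_gt0) hm; move: hj; lra.
rewrite [leRHS]mulrAC ler_wpM2r ?(ltW r1_gt0)// ler_pdivrMr//.
rewrite mulrAC ler_pdivlMr// (le_trans (y := 2 * K%:R))//; last by nra.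
by nra.
Qed.

End Heat.

(** * Finite combinations of point masses *)

Section PointMasses.
Variable R : realType.

(** The bound [mass v X <= b] without extended reals (see [mass_leP]).  Finite
    sums can be split, reindexed and exchanged in the reals, and a family [D]
    of points may be replaced by its image under an injective map without any
    discussion of summability. *)
Definition sums_le (T : choiceType) (v : T -> R) (X : set T) (b : R) :=
  forall D : seq T, uniq D -> (forall h, h \in D -> X h) ->
    \sum_(h <- D) v h <= b.

Lemma mass_leP (T : choiceType) (v : T -> R) (X : set T) (b : R) :
  (mass v X <= b%:E)%E <-> sums_le v X b.
Proof.
split=> [vb D D_uniq DX|vb].
  rewrite -lee_fin; apply: le_trans vb; apply: ereal_sup_ubound => /=.
  exists [set` D].
    by split; [exact: finite_seq | move=> x /= /DX].
  by rewrite -fsbig_seq// sumEFin.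
rewrite /mass /esum; apply: ge_ereal_sup => _ [A [Afin AX] <-].
rewrite fsbig_finite//= sumEFin lee_fin; apply: vb => [|h].
  exact: fset_uniq.
by rewrite in_fset_set// inE => /AX.
Qed.

Definition nneg_weights (T : Type) (r : seq (T * R)) :=
  all (fun q => 0 <= q.2) r.

Definition pmass (T : choiceType) (r : seq (T * R)) : T -> R :=
  fun g => \sum_(q <- r) q.2 * (q.1 == g)%:R.

Lemma pmass_ge0 (T : choiceType) (r : seq (T * R)) g :
  nneg_weights r -> 0 <= pmass r g.
Proof.
move=> /allP r_ge0; rewrite /pmass big_seq sumr_ge0// => q /r_ge0 q_ge0.
by rewrite mulr_ge0.
Qed.

Lemma esum_pmass (T : choiceType) (r : seq (T * R)) (f : T -> R) :
  nneg_weights r -> (forall h, 0 <= f h) ->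
  (\esum_(h in [set: T]) (pmass r h * f h)%:E =
   (\sum_(q <- r) q.2 * f q.1)%:E)%E.
Proof.
move=> r_ge0 f_ge0; elim: r r_ge0 => [_|q r IH /= /andP[q_ge0 r_ge0]].
  rewrite big_nil esum1// => h _.
  by rewrite /pmass big_nil mul0r.
rewrite big_cons EFinD -IH//.
transitivity (\esum_(h in [set: T]) ((q.2 * (q.1 == h)%:R * f h)%:E +
    (pmass r h * f h)%:E))%E.
  by apply: eq_esum => h _; rewrite /pmass big_cons mulrDl EFinD.
rewrite esumD => [||h _]; last 2 first.
- by move=> h _; rewrite lee_fin !mulr_ge0.
- by rewrite lee_fin mulr_ge0 ?pmass_ge0.
congr (_ + _)%E.
rewrite -[RHS](@esum_set1 _ _ q.1 (fun h => (q.2 * f h)%:E)); last first.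
  by rewrite lee_fin mulr_ge0.
rewrite [RHS]esum_mkcond; apply: eq_esum => h _.
rewrite eq_sym; have [->|hq] := eqVneq h q.1.
  by rewrite mem_set//= mulr1.
by rewrite memNset ?mulr0 ?mul0r//= => /eqP; rewrite (negPf hq).
Qed.

Lemma mass_pmass (T : choiceType) (r : seq (T * R)) : nneg_weights r ->
  mass (pmass r) [set: T] = (\sum_(q <- r) q.2)%:E.
Proof.
move=> r_ge0; rewrite -(eq_bigr _ (fun q _ => mulr1 q.2)).
rewrite -[RHS](esum_pmass (f := fun=> 1))//.
by apply: eq_esum => h _; rewrite mulr1.
Qed.

Lemma push_pmass (T U : choiceType) (phi : T -> U) (r : seq (T * R)) :
  nneg_weights r -> push phi (pmass r) = pmass [seq (phi q.1, q.2) | q <- r].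
Proof.
move=> r_ge0; apply/funext => u; rewrite /push /mass esum_mkcond.
rewrite [X in fine X](_ : _ =
   \esum_(h in [set: T]) (pmass r h * (phi h == u)%:R)%:E)%E.
  by rewrite esum_pmass//= /pmass big_map.
apply: eq_esum => h _; case: eqVneq => [hu|/eqP hu].
  by rewrite mem_set//= mulr1.
by rewrite memNset//= mulr0.
Qed.

Lemma convol_pmassl (G : groupType) (r : seq (G * R)) (nu : G -> R) (g : G) :
  nneg_weights r -> (forall h, 0 <= nu h) ->
  convol (pmass r) nu g = \sum_(q <- r) q.2 * nu (q.1^-1 * g)%g.
Proof. by move=> r_ge0 nu_ge0; rewrite /convol esum_pmass. Qed.

Definition prod_weights (G : groupType) (r r' : seq (G * R)) : seq (G * R) :=
  [seq ((q.1 * q'.1)%g, q.2 * q'.2) | q <- r, q' <- r'].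

Lemma prod_weights_ge0 (G : groupType) (r r' : seq (G * R)) :
  nneg_weights r -> nneg_weights r' -> nneg_weights (prod_weights r r').
Proof.
move=> /allP r_ge0 /allP r'_ge0; apply/allP => q.
move=> /allpairsP[[q1 q2] /= [/r_ge0 h1 /r'_ge0 h2 ->]] /=.
exact: mulr_ge0.
Qed.

Lemma convol_pmass (G : groupType) (r r' : seq (G * R)) :
  nneg_weights r -> nneg_weights r' ->
  convol (pmass r) (pmass r') = pmass (prod_weights r r').
Proof.
move=> r_ge0 r'_ge0; apply/funext => g.
rewrite convol_pmassl// => [|h]; last exact: pmass_ge0.
rewrite /pmass /prod_weights big_allpairs_dep; apply: eq_bigr => q _.
rewrite mulr_sumr; apply: eq_bigr => q' _ /=; rewrite mulrA.
by congr (_ * (_ : bool)%:R); rewrite (can2_eq (mulKg _) (mulVKg _)).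
Qed.

Lemma sum_prod_weights (G : groupType) (r r' : seq (G * R)) :
  \sum_(q <- prod_weights r r') q.2 = (\sum_(q <- r) q.2) * \sum_(q <- r') q.2.
Proof.
rewrite /prod_weights big_allpairs_dep mulr_suml; apply: eq_bigr => q _.
by rewrite mulr_sumr.
Qed.

Section Powers.
Variables (G : groupType) (r : seq (G * R)).
Hypotheses (r_ge0 : nneg_weights r) (r_sum : \sum_(q <- r) q.2 = 1).

Lemma convol_pow_pmass n : exists r' : seq (G * R),
  [/\ nneg_weights r', \sum_(q <- r') q.2 = 1 &
      convol_pow (pmass r) n = pmass r'].
Proof.
elim: n => [|n [r' [r'_ge0 r'_sum IH]]].
  exists [:: (1%g, 1)]; split; first by rewrite /= ler01.
    by rewrite big_seq1.
  by apply/funext => g; rewrite /pmass /= big_seq1 mul1r eq_sym.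
exists (prod_weights r r'); split; first exact: prod_weights_ge0.
  by rewrite sum_prod_weights r_sum r'_sum mulr1.
by rewrite /= IH convol_pmass.
Qed.

Lemma convol_pow_pmass_ge0 n g : 0 <= convol_pow (pmass r) n g.
Proof. by have [r' [? _ ->]] := convol_pow_pmass n; rewrite pmass_ge0. Qed.

Lemma mass_convol_pow n : mass (convol_pow (pmass r) n) [set: G] = 1%E.
Proof.
by have [r' [? r'1 ->]] := convol_pow_pmass n; rewrite mass_pmass// r'1.
Qed.

Lemma convol_powSl n g :
  convol_pow (pmass r) n.+1 g =
  \sum_(q <- r) q.2 * convol_pow (pmass r) n (q.1^-1 * g)%g.
Proof. by rewrite /= convol_pmassl//; exact: convol_pow_pmass_ge0. Qed.

(** Left and right convolution by the same measure agree on the Dirac mass at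
    the identity and commute.  Multiplication on the right is the useful one:
    the increments then act near the current position of the cursor. *)
Lemma convol_powSr n g :
  convol_pow (pmass r) n.+1 g =
  \sum_(q <- r) q.2 * convol_pow (pmass r) n (g * q.1^-1)%g.
Proof.
elim: n g => [|n IH] g.
  rewrite convol_powSl; apply: eq_bigr => q _ /=.
  rewrite -(inj_eq (mulgI q.1)) mulVKg mulg1.
  by rewrite -[in RHS](inj_eq (mulIg q.1)) mulgVK mul1g.
rewrite convol_powSl (eq_bigr _ (fun q _ => congr1 _ (IH _))).
under eq_bigr do rewrite mulr_sumr.
rewrite exchange_big; apply: eq_bigr => q _; rewrite convol_powSl mulr_sumr.
by apply: eq_bigr => q' _; rewrite mulgA mulrCA.
Qed.

End Powers.
End PointMasses.

(** * The switch-walk-switch walk *)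

Definition pos (F : finGroupType) (h : wreath Zgrp F) : int := cursor h.

Definition walk (F : finGroupType) (h : wreath Zgrp F) (k : int) :=
  (h * inj_cursor F (k : Zgrp))%g.

Definition switch (F : finGroupType) (h : wreath Zgrp F) (c : F) :=
  (h * inj_lamp Zgrp c)%g.

Arguments pos {F} h : simpl never.
Arguments walk {F} h k : simpl never.
Arguments switch {F} h c : simpl never.

Section Walk.
Variable F : finGroupType.
Implicit Types (h g : wreath Zgrp F) (c : F) (k z : int).

Lemma wreath_ext h g : pos h = pos g -> lamps h =1 lamps g -> h = g.
Proof. by move=> hg lhg; apply: wreath_eq. Qed.

Lemma pos_mul h g : pos (h * g)%g = pos h + pos g.
Proof. by []. Qed.

Lemma lamps_mul h g z : lamps (h * g)%g z = (lamps h z * lamps g (z - pos h))%g.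
Proof. by rewrite /= fsmulE wshiftE addrC. Qed.

Lemma pos_walk h k : pos (walk h k) = pos h + k.
Proof. by []. Qed.

Lemma lamps_walk h k : lamps (walk h k) = lamps h.
Proof. by apply/fsfunP => z; rewrite lamps_mul fsfun0E mulg1. Qed.

Lemma pos_switch h c : pos (switch h c) = pos h.
Proof. exact: addr0. Qed.

Lemma lamps_switch h c z :
  lamps (switch h c) z = if z == pos h then (lamps h z * c)%g else lamps h z.
Proof.
by rewrite lamps_mul fsfunE inE subr_eq0; case: eqP => //; rewrite mulg1.
Qed.

Lemma walk0 h : walk h 0 = h.
Proof. by apply: wreath_ext => [|z]; rewrite ?lamps_walk// pos_walk addr0. Qed.

Lemma walkD h k l : walk (walk h k) l = walk h (k + l).
Proof. by apply: wreath_ext => [|z]; rewrite ?lamps_walk// !pos_walk addrA. Qed.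

Lemma switch_switch h c c' : switch (switch h c) c' = switch h (c * c')%g.
Proof.
apply: wreath_ext => [|z]; rewrite ?pos_switch// !lamps_switch pos_switch.
by case: eqP => //; rewrite mulgA.
Qed.

Lemma switch1 h : switch h 1%g = h.
Proof.
apply: wreath_ext => [|z]; rewrite ?pos_switch// !lamps_switch.
by case: eqP => //; rewrite mulg1.
Qed.

Lemma mulg_walkV h k : (h * (inj_cursor F (k : Zgrp))^-1)%g = walk h (- k).
Proof.
apply: (mulIg (inj_cursor F (k : Zgrp))); rewrite mulgVK -[RHS]/(walk _ k).
by rewrite walkD addNr walk0.
Qed.

Lemma mulg_switchV h c : (h * (inj_lamp Zgrp c)^-1)%g = switch h c^-1%g.
Proof.
apply: (mulIg (inj_lamp Zgrp c)); rewrite mulgVK -[RHS]/(switch _ c).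
by rewrite switch_switch mulVg switch1.
Qed.

Lemma walk_inj k : injective (fun h => walk h k).
Proof. by move=> h h' /mulIg. Qed.

Lemma switch_inj c : injective (fun h => switch h c).
Proof. by move=> h h' /mulIg. Qed.

Variables (R : realType) (p : R).
Implicit Types v : wreath Zgrp F -> R.

Definition switch_avg v : wreath Zgrp F -> R :=
  fun h => #|F|%:R^-1 * \sum_(c : F) v (switch h c).

Definition walk_avg v : wreath Zgrp F -> R :=
  fun h => (1 - 2 * p) * v h + p * (v (walk h 1) + v (walk h (- 1))).

Definition lamp_weights : seq (wreath Zgrp F * R) :=
  [seq (inj_lamp Zgrp c, #|F|%:R^-1) | c <- enum F].

Definition cursor_weights : seq (wreath Zgrp F * R) :=
  [seq (inj_cursor F (q.1 : Zgrp), q.2)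
     | q <- [:: (-1, p); (0, 1 - 2 * p); (1, p)]].

Definition sws_weights :=
  prod_weights (prod_weights lamp_weights cursor_weights) lamp_weights.

Lemma card_neq0 : #|F|%:R != 0 :> R.
Proof. by rewrite pnatr_eq0 -lt0n; apply/card_gt0P; exists 1%g. Qed.

Lemma lamp_weights_ge0 : nneg_weights lamp_weights.
Proof. by apply/allP => _ /mapP[c _ ->] /=; rewrite invr_ge0. Qed.

Lemma sum_lamp_weights : \sum_(q <- lamp_weights) q.2 = 1.
Proof.
rewrite big_map /= big_enum/= sumr_const -[_ *+ _]mulr_natl.
by rewrite mulfV// card_neq0.
Qed.

Lemma sum_cursor_weights : \sum_(q <- cursor_weights) q.2 = 1.
Proof. by rewrite !big_cons big_nil /=; lra. Qed.

Lemma sum_sws_weights : \sum_(q <- sws_weights) q.2 = 1.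
Proof.
by rewrite !sum_prod_weights sum_lamp_weights sum_cursor_weights !mulr1.
Qed.

Lemma sws_weights_ge0 : 0 < p -> 2 * p < 1 -> nneg_weights sws_weights.
Proof.
move=> p_gt0 p_lt; apply: prod_weights_ge0 (lamp_weights_ge0).
apply: prod_weights_ge0 lamp_weights_ge0 _.
by rewrite /= subr_ge0 !ltW.
Qed.

Definition right_avg (r : seq (wreath Zgrp F * R)) v : wreath Zgrp F -> R :=
  fun h => \sum_(q <- r) q.2 * v (h * q.1^-1)%g.

Lemma right_avg_prod (r r' : seq (wreath Zgrp F * R)) v :
  right_avg (prod_weights r r') v = right_avg r' (right_avg r v).
Proof.
apply/funext => h; rewrite /right_avg /prod_weights big_allpairs_dep.
rewrite exchange_big; apply: eq_bigr => q' _; rewrite mulr_sumr.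
by apply: eq_bigr => q _ /=; rewrite invgM mulgA mulrCA mulrA.
Qed.

(** The inverses disappear because the uniform distribution and the
    distribution of the move are symmetric. *)
Lemma right_avg_lamp v : right_avg lamp_weights v = switch_avg v.
Proof.
apply/funext => h; rewrite /right_avg /switch_avg big_map big_enum/=.
rewrite mulr_sumr (reindex_inj invg_inj) /=; apply: eq_bigr => c _.
by rewrite mulg_switchV invgK.
Qed.

Lemma right_avg_cursor v : right_avg cursor_weights v = walk_avg v.
Proof.
apply/funext => h; rewrite /right_avg /walk_avg !big_cons big_nil/=.
by rewrite !mulg_walkV opprK oppr0 walk0; lra.
Qed.

End Walk.

Lemma switch_walk_switch_weights (F : finGroupType) (R : realType)
    (mu : wreath Zgrp F -> R) :
  switch_walk_switch mu ->
  exists2 p : R, 0 < p /\ 2 * p < 1 & mu = pmass (sws_weights F p).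
Proof.
case=> muZ [[muZ_ge0 muZ1] sym /seteqP[supp supp'] /= ->].
have muZ_gt0 k : [set -1; 0; 1 : int] k -> 0 < muZ k.
  by move=> /supp' /= k0; rewrite lt_def k0 muZ_ge0.
have p_gt0 : 0 < muZ 1 by apply: muZ_gt0; right.
have q_gt0 : 0 < muZ 0 by apply: muZ_gt0; left; right.
have muZE : muZ = pmass [:: (-1 : int, muZ 1); (0, muZ 0); (1, muZ 1)].
  apply/funext => k; rewrite /pmass !big_cons big_nil /=.
  have [k0|k_neq0] := eqVneq (muZ k) 0; last first.
    by have [[->|->]|->] := supp k k_neq0;
      rewrite ?sym /= ?mulr1 ?mulr0 ?addr0 ?add0r.
  case: eqP k0 => [<-|_].
    by rewrite sym => p0; move: p_gt0; rewrite p0 ltxx.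
  case: eqP => [<- q0|_]; first by move: q_gt0; rewrite q0 ltxx.
  case: eqP => [<- p0|_ ->]; first by move: p_gt0; rewrite p0 ltxx.
  by rewrite !mulr0 !addr0.
have sum1 : muZ 1 + (muZ 0 + muZ 1) = 1.
  move: muZ1; rewrite {1}muZE mass_pmass /=; last by rewrite !ltW.
  by rewrite !big_cons big_nil /= addr0 => -[].
have q_eq : muZ 0 = 1 - 2 * muZ 1 by lra.
exists (muZ 1); first by split=> //; lra.
have unifE : unif_mass R (F := F) = pmass [seq (c, #|F|%:R^-1) | c <- enum F].
  apply/funext => c; rewrite /pmass big_map big_enum/= (bigD1 c)//= eqxx mulr1.
  by rewrite big1 ?addr0// => c' /negPf ->; rewrite mulr0.
have unif_ge0 : nneg_weights [seq (c, #|F|%:R^-1 : R) | c <- enum F].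
  by apply/allP => _ /mapP[c _ ->] /=; rewrite invr_ge0.
have pushF : push (@inj_lamp Zgrp F) (unif_mass R (F := F)) =
    pmass (lamp_weights F R).
  by rewrite unifE push_pmass// -map_comp.
have pushZ : push (@inj_cursor Zgrp F) muZ = pmass (cursor_weights F (muZ 1)).
  rewrite {1}muZE push_pmass /=; last by rewrite !ltW.
  by rewrite /cursor_weights /= -q_eq.
have c_ge0 : nneg_weights (cursor_weights F (muZ 1)).
  by rewrite /cursor_weights /= -q_eq !ltW.
have l_ge0 := @lamp_weights_ge0 F R.
by rewrite pushF pushZ !convol_pmass//; exact: prod_weights_ge0.
Qed.

(** * Structure of the law at time n *)

Section Law.
Variables (F : finGroupType) (R : realType) (p : R).
Implicit Types (h g : wreath Zgrp F) (c : F) (k z : int).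
Implicit Types v : wreath Zgrp F -> R.

Definition law n : wreath Zgrp F -> R := convol_pow (pmass (sws_weights F p)) n.

Lemma switch_avg_switch v h c : switch_avg v (switch h c) = switch_avg v h.
Proof.
rewrite /switch_avg [in RHS](reindex_inj (mulgI c)) /=.
by under eq_bigr do rewrite switch_switch.
Qed.

Lemma switch_avg_id v h :
  (forall c, v (switch h c) = v h) -> switch_avg v h = v h.
Proof.
move=> vh; rewrite /switch_avg (eq_bigr _ (fun c _ => vh c)).
by rewrite sumr_const -[v h *+ _]mulr_natl mulrA mulVf ?mul1r ?card_neq0.
Qed.

Lemma switch_avgK v : switch_avg (switch_avg v) = switch_avg v.
Proof.
by apply/funext => h; apply: switch_avg_id => c; exact: switch_avg_switch.
Qed.

Definition lit_in (a b : int) h :=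
  all (fun z : int => a <= z <= b) (finsupp (lamps h)).

Lemma lit_inP a b h :
  reflect (forall z, lamps h z != 1%g -> a <= z <= b) (lit_in a b h).
Proof.
apply: (iffP allP) => H z; first by move=> hz; apply: H; rewrite mem_finsupp.
by rewrite mem_finsupp => /H.
Qed.

(** Up to a factor, the law of the position given that the cursor is at [x] and
    that it has visited the interval [[a, b]]. *)
Definition cell (x a b : int) h : R := ((pos h == x) && lit_in a b h)%:R.

(** The condition [a <= x <= b] expresses that the lamp under the cursor has
    been refreshed, which is the case at all times [n >= 1]. *)
Inductive cone : (wreath Zgrp F -> R) -> Prop :=
| cone0 : cone (fun=> 0)
| cone_cons x a b (r : R) v : a <= x <= b -> cone v ->
    cone (fun h => r * cell x a b h + v h).

Lemma cone_add v w : cone v -> cone w -> cone (fun h => v h + w h).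
Proof.
elim=> [|x a b r {}v axb _ IH] cw.
  by rewrite (_ : (fun=> _) = w)//; apply/funext => h; rewrite add0r.
have := cone_cons r axb (IH cw); congr cone; apply/funext => h.
by rewrite addrA.
Qed.

(** Refreshing the lamp at [x] adds [x] to the interval of uniform lamps.  If
    [x] was not in it, exactly one value of the refreshed lamp leads to a
    configuration in which the lamp at [x] was off, whence the factor
    [#|F|^-1].  The empty interval, [b = a - 1], is allowed so as to cover the
    Dirac mass (see [law0E]). *)
Lemma switch_avg_cell x a b : a - 1 <= b -> a - 1 <= x <= b + 1 ->
  exists r : R, switch_avg (cell x a b) =
    fun h => r * cell x (Num.min a x) (Num.max b x) h.
Proof.
move=> ab axb; have [xin|xout] := boolP (a <= x <= b).
  exists 1; apply/funext => h; rewrite mul1r.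
  have -> : Num.min a x = a by lia.
  have -> : Num.max b x = b by lia.
  apply: switch_avg_id => c; rewrite /cell pos_switch.
  have [hx|//] := eqVneq (pos h) x; congr (nat_of_bool _)%:R => /=.
  apply/lit_inP/lit_inP => H z; have := H z; rewrite lamps_switch hx;
    by case: (z =P x) => [->|].
exists #|F|%:R^-1; apply/funext => h; rewrite /switch_avg; congr (_ * _).
rewrite /cell; have [hx|hx] := eqVneq (pos h) x; last first.
  by rewrite big1// => c _; rewrite pos_switch (negPf hx).
rewrite (bigD1 (lamps h x)^-1%g)//= big1 => [|c hc].
  rewrite addr0 pos_switch hx eqxx; congr (nat_of_bool _)%:R => /=.
  apply/lit_inP/lit_inP => H z; have := H z; rewrite lamps_switch hx.
    by case: (z =P x) => [->|_ + hz]; [lia|move=> /(_ hz); lia].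
  case: (z =P x) => [->|zx]; first by rewrite mulgV eqxx.
  by move=> + hz => /(_ hz); lia.
rewrite pos_switch hx eqxx /=; case: lit_inP => // /(_ x).
rewrite lamps_switch hx eqxx (negPf xout); case: eqP => [e _|_ /(_ isT)//].
by case/eqP: hc; rewrite -[c](mulKg (lamps h x)) e mulg1.
Qed.

Lemma cone_switch_avg_cell x a b r : a - 1 <= b -> a - 1 <= x <= b + 1 ->
  cone (fun h => r * switch_avg (cell x a b) h).
Proof.
move=> ab axb; have [r' ->] := switch_avg_cell ab axb.
have xin : Num.min a x <= x <= Num.max b x by lia.
have := cone_cons (r * r') xin cone0; congr cone; apply/funext => h.
by rewrite addr0 mulrA.
Qed.

Lemma walk_avg_cell x a b h : walk_avg p (cell x a b) h =
  (1 - 2 * p) * cell x a b h + p * (cell (x - 1) a b h + cell (x + 1) a b h).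
Proof.
rewrite /walk_avg /cell /lit_in !lamps_walk !pos_walk.
have -> : (pos h + 1 == x) = (pos h == x - 1) by lia.
by have -> : (pos h - 1 == x) = (pos h == x + 1) by lia.
Qed.

Lemma cone_avg v : cone v -> cone (switch_avg (walk_avg p v)).
Proof.
elim=> [|x a b r {}v axb _ IH].
  have := cone0; congr cone; apply/funext => h; rewrite /switch_avg /walk_avg.
  by rewrite big1 ?mulr0// => c _; lra.
have c0 := @cone_switch_avg_cell x a b (r * (1 - 2 * p)) ltac:(lia) ltac:(lia).
have c1 := @cone_switch_avg_cell (x - 1) a b (r * p) ltac:(lia) ltac:(lia).
have c2 := @cone_switch_avg_cell (x + 1) a b (r * p) ltac:(lia) ltac:(lia).
have := cone_add c0 (cone_add c1 (cone_add c2 IH)).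
congr cone; apply/funext => h; rewrite /switch_avg.
rewrite [_ * (_^-1 * _)]mulrCA ![r * p * (_^-1 * _)]mulrCA -!mulrDr.
congr (_ * _); rewrite !mulr_sumr -!big_split /=; apply: eq_bigr => c _.
have := congr1 ( *%R r) (walk_avg_cell x a b (switch h c)).
by rewrite /walk_avg => e; lra.
Qed.

Lemma law0E h : law 0 h = cell 0 1 0 h.
Proof.
rewrite /law /= /cell; congr (nat_of_bool _)%:R.
apply/eqP/andP => [->|[/eqP h0 /lit_inP H]].
  by split; [exact/eqP|apply/lit_inP => z; rewrite fsfun0E eqxx].
apply: wreath_ext => // z; rewrite fsfun0E; apply/eqP/negPn/negP => /H; lia.
Qed.

(** An interval that contains the lit lamps of [h] contains [[a, b]], and so
    does one that contains the lit lamps of [g]; what happens strictly between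
    [a] and [b] is then irrelevant. *)
Lemma cone_hull v h g (a b : int) : cone v -> pos h = pos g ->
  lamps h a != 1%g -> lamps h b != 1%g ->
  (forall z, z <= a \/ b <= z -> lamps h z = lamps g z) -> v h = v g.
Proof.
move=> cv hg ha hb hgab; elim: cv => // x i j r {}v _ _ ->; congr (_ * _ + _).
rewrite /cell hg; congr (nat_of_bool (_ && _))%:R.
have ga : lamps g a != 1%g by rewrite -hgab//; left.
have gb : lamps g b != 1%g by rewrite -hgab//; right.
have lit_sub (f g' : wreath Zgrp F) : lamps f a != 1%g -> lamps f b != 1%g ->
    (forall z, z <= a \/ b <= z -> lamps f z = lamps g' z) ->
    lit_in i j f -> lit_in i j g'.
  move=> fa fb fg /lit_inP H; apply/lit_inP => z hz.
  have := H a fa; have := H b fb; have := H z.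
  have [za|az] := leP z a; first by rewrite fg; [move=> /(_ hz)|left].
  have [bz|zb] := leP b z; first by rewrite fg; [move=> /(_ hz)|right].
  by lia.
apply/idP/idP; first exact: lit_sub ha hb hgab.
by apply: lit_sub ga gb _ => z /hgab.
Qed.

Hypotheses (p_gt0 : 0 < p) (p_lt : 2 * p < 1).

Lemma lawS n : law n.+1 = switch_avg (walk_avg p (switch_avg (law n))).
Proof.
apply/funext => h; rewrite /law convol_powSr; last 2 first.
- exact: sws_weights_ge0.
- exact: sum_sws_weights.
by rewrite -[LHS]/(right_avg _ _ _) /sws_weights !right_avg_prod !right_avg_lamp
  right_avg_cursor.
Qed.

Lemma law_ge0 n h : 0 <= law n h.
Proof.
apply: convol_pow_pmass_ge0; last exact: sum_sws_weights.
exact: sws_weights_ge0.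
Qed.

Lemma mass_law n : mass (law n) [set: _] = 1%E.
Proof.
apply: mass_convol_pow; last exact: sum_sws_weights.
exact: sws_weights_ge0.
Qed.

Lemma law_sum_le1 n : sums_le (law n) [set: _] 1.
Proof. by apply/mass_leP; rewrite mass_law. Qed.

Lemma law_switch n h c : law n.+1 (switch h c) = law n.+1 h.
Proof. by rewrite lawS switch_avg_switch. Qed.

Lemma cone_switch_avg_law n : cone (switch_avg (law n)).
Proof.
elim: n => [|n IH].
  have := @cone_switch_avg_cell 0 1 0 1 ltac:(lia) ltac:(lia).
  by congr cone; apply/funext => h; rewrite mul1r (funext law0E).
by rewrite lawS switch_avgK; exact: cone_avg.
Qed.

Lemma cone_law n : cone (law n.+1).
Proof. by rewrite lawS; apply: cone_avg; exact: cone_switch_avg_law. Qed.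

End Law.

(** * Lit lamps on both sides of the cursor *)

Section Tails.
Variables (F : finGroupType) (R : realType) (p : R).
Implicit Types (h g : wreath Zgrp F) (c : F) (k z : int).
Implicit Types v : wreath Zgrp F -> R.
Implicit Types X Y : set (wreath Zgrp F).

Lemma sums_le_walk v X Y b k :
  sums_le v X b -> (forall h, Y h -> X (walk h k)) ->
  sums_le (fun h => v (walk h k)) Y b.
Proof.
move=> vXb YX D D_uniq DY.
rewrite -(big_map (fun h => walk h k) xpredT v); apply: vXb.
  by rewrite map_inj_uniq//; exact: walk_inj.
by move=> _ /mapP[h hD ->]; apply/YX/DY.
Qed.

Lemma sums_le_switch_avg v X b : sums_le v X b ->
  (forall h c, X h -> X (switch h c)) -> sums_le (switch_avg v) X b.
Proof.
move=> vXb Xs D D_uniq DX; rewrite -mulr_sumr exchange_big /=.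
rewrite mulrC ler_pdivrMr; last first.
  by rewrite lt_def card_neq0 ler0n.
rewrite mulr_natr -sumr_const; apply: ler_sum => c _.
rewrite -(big_map (fun h => switch h c) xpredT v); apply: vXb.
  by rewrite map_inj_uniq//; exact: switch_inj.
by move=> _ /mapP[h hD ->]; apply/Xs/DX.
Qed.

(** With [s] equal to [1] or [-1], one definition serves both sides. *)
Definition tail (s y : int) : set (wreath Zgrp F) :=
  [set h | forall z : int, y < s * z -> lamps h (pos h + z) = 1%g].

Lemma tail_walk s y k h : tail s y h -> tail s (y - s * k) (walk h k).
Proof.
move=> hy z yz; rewrite lamps_walk pos_walk -addrA; apply: hy.
by rewrite mulrDr -ltrBlDl.
Qed.

Lemma tail_switch s y c h : 0 <= y -> tail s y h -> tail s y (switch h c).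
Proof.
move=> y_ge0 hy z yz; rewrite lamps_switch pos_switch; case: eqP => [z0|_].
  have z_eq0 : z = 0 by lia.
  by move: yz; rewrite z_eq0 mulr0; lia.
exact: hy.
Qed.

(** The elements of [tail s (-1)] have their lamp under the cursor off, so
    setting this lamp to each of its [#|F|] values gives [#|F|] disjoint copies
    of [tail s (-1)] inside [tail s 0]. *)
Lemma sums_le_switch_tail v s b : sums_le v (tail s 0) b ->
  sums_le (switch_avg v) (tail s (- 1)) (#|F|%:R^-1 * b).
Proof.
move=> vb D D_uniq D_tail; rewrite -mulr_sumr ler_wpM2l ?invr_ge0//.
have -> : \sum_(h <- D) \sum_(c : F) v (switch h c) =
    \sum_(g <- [seq switch h c | h <- D, c <- enum F]) v g.
  by rewrite big_allpairs_dep; apply: eq_bigr => h _; rewrite big_enum.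
have lamp1 h : h \in D -> lamps h (pos h) = 1%g.
  by move=> /D_tail/(_ 0); rewrite mulr0 addr0 => ->.
apply: vb => [|g /allpairsP[[h c] [/= hD _ ->]]].
  apply: allpairs_uniq => //; first exact: enum_uniq.
  move=> [h c] [h' c'] /allpairsP[[x y] [/= xD _ [-> ->]]].
  move=> /allpairsP[[x' y'] [/= x'D _ [-> ->]]] /= eq_hc.
  have eq_pos : pos x = pos x' by rewrite -(pos_switch x y) eq_hc pos_switch.
  have : lamps (switch x y) (pos x) = lamps (switch x' y') (pos x').
    by rewrite eq_hc eq_pos.
  rewrite !lamps_switch !eqxx !lamp1// !mul1g => eq_y.
  by move: eq_hc; rewrite eq_y => /switch_inj ->.
move=> z z_gt0; rewrite lamps_switch pos_switch; case: eqP => [z0|_].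
  have z_eq0 : z = 0 by lia.
  by move: z_gt0; rewrite z_eq0 mulr0.
by apply: (D_tail _ hD); rewrite (le_lt_trans _ z_gt0).
Qed.

(** For the trivial group no lamp can be lit, but then the lamps carry no
    information and the law is just that of a lazy walk on the integers;
    counting every element as flanked makes the two cases uniform. *)
Definition flanked (K : int) h := #|F| = 1%N \/
  exists a b : int, [/\ a < - K, K < b, lamps h (pos h + a) != 1%g &
                     lamps h (pos h + b) != 1%g].

Lemma not_flanked K h : ~ flanked K h ->
  (1 < #|F|)%N /\ (tail 1 K h \/ tail (- 1) K h).
Proof.
move=> hK; split.
  have F_gt0 : (0 < #|F|)%N by apply/card_gt0P; exists 1%g.
  by rewrite ltn_neqAle F_gt0 andbT eq_sym; apply/eqP => F1; case: hK; left.
apply: contrapT => /not_orP[/existsNP[b] /not_implyP[Kb /eqP hb]].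
move=> /existsNP[a] /not_implyP[Ka /eqP ha]; apply: hK; right.
by exists a, b; split=> //; [lia|rewrite mul1r in Kb].
Qed.

Lemma flankedW K K' h : K' <= K -> flanked K h -> flanked K' h.
Proof.
move=> KK' [|[a [b [aK Kb ha hb]]]]; [by left|right; exists a, b].
by split=> //; lia.
Qed.

Lemma flanked_walk K k h : flanked K h -> flanked (K - `|k|) (walk h k).
Proof.
case=> [|[a [b [aK Kb ha hb]]]]; [by left|right; exists (a - k), (b - k)].
rewrite lamps_walk pos_walk; split; [lia|lia|..].
  by rewrite addrACA subrr addr0.
by rewrite addrACA subrr addr0.
Qed.

Hypotheses (p_gt0 : 0 < p) (p_lt : 2 * p < 1).

(** Comparison with [sgn_heat].  For [y >= 1] a step shifts [y] like the walk.
    At [y = 0] a move into the tail leads to [tail s (-1)], which weighs at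
    most [2^-1 * sgn_heat p n 2]; by concavity this is at most
    [sgn_heat p n 1], the value that the comparison function takes at
    [y = - 1].  The shift by [2] leaves room for this argument. *)
Lemma law_tail (s : int) n (y : int) : (1 < #|F|)%N -> s = 1 \/ s = -1 ->
  0 <= y -> sums_le (law p n) (tail s y) (sgn_heat p n (y + 2)).
Proof.
move=> F_gt1 s1; elim: n y => [|n IH] y y_ge0.
  have -> : sgn_heat p 0 (y + 2) = 1.
    by rewrite /sgn_heat /= gtr0_sgz//; lia.
  by move=> D D_uniq _; exact: (law_sum_le1 p_gt0 p_lt).
rewrite (lawS _ p_gt0 p_lt).
apply: sums_le_switch_avg; last by move=> h c; exact: tail_switch.
have IH' (x : int) : -1 <= x ->
    sums_le (switch_avg (law p n)) (tail s x) (sgn_heat p n (x + 2)).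
  rewrite le_eqVlt => /predU1P[<-|x_gt]; last first.
    have x_ge0 : 0 <= x by lia.
    by apply: sums_le_switch_avg (IH x x_ge0) _ => h c; exact: tail_switch.
  have := sums_le_switch_tail (IH 0 (lexx 0)) => tb D D_uniq D_tail.
  apply: le_trans (tb D D_uniq D_tail) _.
  have := sgn_heat_linear p_gt0 p_lt n 2.
  rewrite add0r -[-1 + 2]/(1 : int) => h2.
  rewrite mulrC ler_pdivrMr ?ltr0n; last by lia.
  apply: le_trans h2 _; rewrite mulrC ler_wpM2l ?ler_nat//.
  exact: sgn_heat_ge0.
move=> D D_uniq D_tail; rewrite sgn_heatS big_split /= -mulr_sumr.
have le_walk k : k = 1 \/ k = -1 ->
    \sum_(h <- D) switch_avg (law p n) (walk h k) <=
      sgn_heat p n (y - s * k + 2).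
  move=> k1; have y'_ge : -1 <= y - s * k by case: s1 k1 => -> [] ->; lia.
  apply: (sums_le_walk (IH' _ y'_ge) (Y := tail s y) _ D_uniq D_tail) => h.
  exact: tail_walk.
have := le_walk 1 (or_introl erefl); have := le_walk (-1) (or_intror erefl).
move=> h1 h2.
rewrite -[X in _ + X <= _]mulr_sumr [X in _ + _ * X <= _]big_split /=.
have [p0 p1] := (p_gt0, p_lt).
apply: lerD; first by rewrite ler_wpM2l ?IH'//; [lra|lia].
rewrite ler_wpM2l ?(ltW p_gt0)//; case: s1 h1 h2 => ->.
  have -> : y - 1 * -1 + 2 = y + 2 + 1 by lia.
  have -> : y - 1 * 1 + 2 = y + 2 - 1 by lia.
  by move=> h1 h2; rewrite addrC; exact: lerD.
have -> : y - -1 * -1 + 2 = y + 2 - 1 by lia.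
have -> : y - -1 * 1 + 2 = y + 2 + 1 by lia.
by move=> h1 h2; exact: lerD.
Qed.

Lemma law_not_flanked n (K : nat) :
  sums_le (law p n) [set h | ~ flanked K%:Z h]
    (2 * (K + 2)%:R * sgn_heat p n 1).
Proof.
move=> D D_uniq D_far; rewrite big_seq.
have s1_ge0 : 0 <= sgn_heat p n 1 by apply: sgn_heat_ge0.
have [F_le1|F_gt1] := leqP #|F| 1.
  rewrite big1 ?mulr_ge0// => h /D_far /not_flanked[].
  by rewrite ltnNge F_le1.
pose D' s := [seq h <- D | `[< tail s K%:Z h >]].
have D'_le s : s = 1 \/ s = -1 ->
    \sum_(h <- D' s) law p n h <= (K + 2)%:R * sgn_heat p n 1.
  move=> s1; have := law_tail n F_gt1 s1 (isT : 0 <= K%:Z).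
  move=> /(_ (D' s) (filter_uniq _ D_uniq)) D'_sum.
  apply: le_trans (D'_sum _) _ => [h|].
    by rewrite mem_filter => /andP[/asboolP].
  by have := sgn_heat_linear p_gt0 p_lt n (K + 2); rewrite PoszD.
have D'1 := D'_le 1 (or_introl erefl); have D'2 := D'_le (-1) (or_intror erefl).
rewrite -mulrA [2 * _]mulr_natl mulr2n; apply: le_trans (lerD D'1 D'2).
rewrite /D' !big_filter -big_seq [X in _ <= X + _]big_mkcond.
rewrite [X in _ <= _ + X]big_mkcond -big_split /= big_seq [leRHS]big_seq.
apply: ler_sum => h /D_far /not_flanked[_ h_tail].
have law0 := law_ge0 p_gt0 p_lt n h.
case: h_tail => h_tail.
  by rewrite ifT; [rewrite lerDl; case: ifP|exact/asboolP].
by rewrite [X in _ + X]ifT; [rewrite lerDr; case: ifP|exact/asboolP].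
Qed.

Lemma law_flanked K n h g k : flanked K h -> pos g = pos h + k ->
  (forall z, K < `|z - pos h| -> lamps g z = lamps h z) ->
  law p n.+1 g = law p n.+1 (walk h k).
Proof.
case=> [F1|[a [b [aK Kb ha hb]]]] pg lg.
  congr law; apply: wreath_ext => // z; rewrite lamps_walk.
  have F_trivial (c : F) : c = 1%g.
    have /fintype_le1P F_eq : (#|F| <= 1)%N by rewrite F1.
    exact: F_eq.
  by rewrite (F_trivial (lamps g z)) (F_trivial (lamps h z)).
have law_cone := cone_law F p_gt0 p_lt n.
apply/esym/(cone_hull (a := pos h + a) (b := pos h + b) law_cone).
- by rewrite pos_walk.
- by rewrite lamps_walk.
- by rewrite lamps_walk.
- by move=> z zab; rewrite lamps_walk lg//; lia.
Qed.

(** Of the two averages over lamps in [lawS], the inner one has no effect as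
    the law is already invariant under switches, and the outer one alters a
    lamp strictly between two lit ones; the average over the move remains. *)
Lemma law_caloric n h : flanked 0 h -> law p n.+2 h =
  (1 - 2 * p) * law p n.+1 h +
  p * (law p n.+1 (walk h 1) + law p n.+1 (walk h (- 1))).
Proof.
move=> h_flanked; rewrite (lawS _ p_gt0 p_lt).
have -> : switch_avg (law p n.+1) = law (F := F) p n.+1.
  by rewrite (lawS _ p_gt0 p_lt) switch_avgK.
apply: switch_avg_id => c; rewrite /walk_avg (law_switch p_gt0 p_lt).
have lawE k : law p n.+1 (walk (switch h c) k) = law p n.+1 (walk h k).
  apply: (@law_flanked 0 n h _ k h_flanked).
    by rewrite pos_walk pos_switch.
  move=> z z0; rewrite lamps_walk lamps_switch; case: eqP => // zh.
  by move: z0; rewrite zh subrr normr0 ltxx.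
by rewrite !lawE.
Qed.

(** With the signs [sg] frozen at time [m], the sum is a difference of two
    values of the function [Hd m]; this function solves the heat equation and
    is bounded by the total mass [1] of the law. *)
Lemma law_gradient : exists2 C : R, 0 < C &
  forall (K n : nat) (D : seq (wreath Zgrp F)), (1 < K)%N -> uniq D ->
  (forall h, h \in D -> flanked K%:Z h) ->
  \sum_(h <- D) `|law p n.+1 (walk h 1) - law p n.+1 h| <=
    C / Num.sqrt n.+1%:R + C / K%:R.
Proof.
have [C C_gt0 gradC] := caloric_gradient p_gt0 p_lt.
exists C => // K m D K_gt1 D_uniq D_flanked.
pose sg h := Num.sg (law p m.+1 (walk h 1) - law p m.+1 h).
pose Hd n (y : int) := \sum_(h <- D) sg h * law p n.+1 (walk h y).
have -> : \sum_(h <- D) `|law p m.+1 (walk h 1) - law p m.+1 h| =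
    Hd m 1 - Hd m 0.
  rewrite /Hd -sumrB; apply: eq_bigr => h _.
  by rewrite walk0 -mulrBr -normrEsg.
apply: le_trans (ler_norm _) _; apply: (gradC Hd K K_gt1) => n y yK.
  apply: le_trans (ler_norm_sum _ _ _) _.
  apply: (@le_trans _ _ (\sum_(h <- D) law p n.+1 (walk h y))).
    apply: ler_sum => h _; rewrite normrM (ger0_norm (law_ge0 p_gt0 p_lt _ _)).
    by rewrite ler_piMl ?(law_ge0 p_gt0 p_lt)// /sg normr_sg lern1 leq_b1.
  have law_le1 := law_sum_le1 (F := F) p_gt0 p_lt n.+1.
  exact: (sums_le_walk (k := y) law_le1 (Y := setT) _ D_uniq).
rewrite /heat /Hd !mulr_sumr -big_split /= mulr_sumr -big_split /=.
rewrite [LHS]big_seq [RHS]big_seq; apply: eq_bigr => h hD.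
rewrite law_caloric; last first.
  by apply: flankedW (flanked_walk y (D_flanked h hD)); lia.
by rewrite !walkD; lra.
Qed.

End Tails.

(** * Typical elements *)

Section Typical.
Variables (F : finGroupType) (R : realType) (p : R).
Hypotheses (p_gt0 : 0 < p) (p_lt : 2 * p < 1).
Implicit Types (h g : wreath Zgrp F).

(** The total variation over the [2 * k] unit shifts of the cursor from [- k]
    to [k], which bounds the effect of all these shifts simultaneously. *)
Definition oscillation (k n : nat) h : R :=
  \sum_(0 <= i < 2 * k) `|law p n.+1 (walk h (i.+1%:Z - k%:Z)) -
                          law p n.+1 (walk h (i%:Z - k%:Z))|.

Lemma oscillation_ge (k n : nat) h (j : int) : `|j| <= k%:Z ->
  `|law p n.+1 (walk h j) - law p n.+1 h| <= oscillation k n h.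
Proof.
move=> jk; pose f (i : nat) := law p n.+1 (walk h (i%:Z - k%:Z)).
have le_osc (a b : nat) : (a <= b)%N -> (b <= 2 * k)%N ->
    `|f b - f a| <= oscillation k n h.
  move=> ab bk; have a2k := leq_trans ab bk; rewrite -telescope_sumr//.
  apply: le_trans (ler_norm_sum _ _ _) _.
  rewrite /oscillation [leRHS](big_cat_nat (n := a))//=.
  rewrite [X in _ <= _ + X](big_cat_nat (n := b))//=.
  by rewrite -[leLHS]add0r lerD ?sumr_ge0// -[leLHS]addr0 lerD ?sumr_ge0.
have fk : f k = law p n.+1 h by rewrite /f subrr walk0.
have [j_ge0|j_lt0] := leP 0 j.
  have <- : f (k + `|j|%N)%N = law p n.+1 (walk h j).
    by rewrite /f; congr (law p _ (walk h _)); lia.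
  by rewrite -fk; apply: le_osc; lia.
have <- : f (k - `|j|%N)%N = law p n.+1 (walk h j).
  by rewrite /f; congr (law p _ (walk h _)); lia.
by rewrite -fk distrC; apply: le_osc; lia.
Qed.

Lemma sum_oscillation : exists2 C : R, 0 < C &
  forall (K k n : nat) (D : seq (wreath Zgrp F)), (k.+1 < K)%N -> uniq D ->
  (forall h, h \in D -> flanked K%:Z h) ->
  \sum_(h <- D) oscillation k n h <=
    (2 * k)%:R * (C / Num.sqrt n.+1%:R + C / (K - k)%:R).
Proof.
have [C C_gt0 gradC] := law_gradient F p_gt0 p_lt.
exists C => // K k n D kK D_uniq DK.
rewrite exchange_big /= mulr_natl -[X in _ *+ X]subn0 -sumr_const_nat.
rewrite !big_nat; apply: ler_sum => i /andP[_ ik].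
have -> : \sum_(h <- D) `|law p n.+1 (walk h (i.+1%:Z - k%:Z)) -
      law p n.+1 (walk h (i%:Z - k%:Z))| =
    \sum_(g <- [seq walk h (i%:Z - k%:Z) | h <- D])
      `|law p n.+1 (walk g 1) - law p n.+1 g|.
  rewrite big_map; apply: eq_bigr => h _; rewrite walkD.
  by have -> : i%:Z - k%:Z + 1 = i.+1%:Z - k%:Z by lia.
apply: gradC => [||_ /mapP[h hD ->]]; first by lia.
  by rewrite map_inj_uniq//; exact: walk_inj.
by apply: flankedW (flanked_walk _ (DK h hD)); lia.
Qed.

(** The balance of the constants, with [s n = sqrt n.+1].  The distance [K n] to
    the lit lamps is [delta * s n], where [delta] is so small that a fraction
    at most [eps / 2] of the elements is not flanked.  The radius [k n] is
    [L * c * s n], where [c] is small compared with [delta] and [L], so that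
    shifts by [k n] remain in the interior, and compared with [eps ^+ 2]: the
    total oscillation is then at most [eps ^+ 2 / 2], and the elements whose
    oscillation exceeds [eps] times their mass have mass at most [eps / 2].
    The hypothesis [1 <= c * s n] makes the roundings in [K n] and [k n]
    harmless. *)
Lemma typical_set (eps : R) (L : nat) : 0 < eps -> (0 < L)%N ->
  exists2 c : R, 0 < c & exists V : nat -> set (wreath Zgrp F), forall n,
   ((1 - eps)%:E <= mass (law p n.+1) (V n))%E /\
   forall h, V n h -> 0 < law p n.+1 h /\
     (1 <= c * Num.sqrt n.+1%:R -> exists k : nat,
       [/\ L%:R * (c * Num.sqrt n.+1%:R) <= k%:R, flanked k%:Z h &
         forall j : int, `|j| <= k%:Z ->
           `|law p n.+1 (walk h j) - law p n.+1 h| <= eps * law p n.+1 h]).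
Proof.
move=> eps_gt0 L_gt0; have [p0 p1] := (p_gt0, p_lt).
have [C C_gt0 oscC] := sum_oscillation.
have LR_gt0 : 0 < L%:R :> R by rewrite ltr0n.
have LR_ge1 : 1 <= L%:R :> R by rewrite ler1n.
pose C1 := 3 / (2 * p).
have C1_gt0 : 0 < C1 by rewrite divr_gt0 ?mulr_gt0.
pose delta := eps / (16 * C1).
have delta_gt0 : 0 < delta by rewrite divr_gt0// mulr_gt0.
pose C2 := C * (1 + 2 / delta).
have C2_gt0 : 0 < C2 by rewrite mulr_gt0// addr_gt0// divr_gt0.
pose c := Num.min (delta / (8 * L%:R)) (eps ^+ 2 / (8 * L%:R * C2)).
have L8_gt0 : 0 < 8 * L%:R :> R by rewrite mulr_gt0.
have LC_gt0 : 0 < 8 * L%:R * C2 by rewrite mulr_gt0.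
have c_gt0 : 0 < c.
  by rewrite lt_min; apply/andP; split; apply: divr_gt0 => //; exact: exprn_gt0.
have c_le1 : 8 * L%:R * c <= delta.
  by rewrite mulrC -ler_pdivlMr// ge_min lexx.
have c_le2 : 8 * L%:R * C2 * c <= eps ^+ 2.
  by rewrite mulrC -ler_pdivlMr// ge_min lexx orbT.
exists c => //.
pose s n : R := Num.sqrt n.+1%:R.
pose K n := (Num.truncn (delta * s n)).+1.
pose k n := (Num.truncn (L%:R * (c * s n))).+1.
exists (fun n => [set h | 0 < law p n.+1 h /\ (1 <= c * s n ->
  flanked (K n)%:Z h /\ oscillation (k n) n h <= eps * law p n.+1 h)]) => n.
have s_gt0 : 0 < s n by rewrite sqrtr_gt0.
have cs_ge0 : 0 <= L%:R * (c * s n) by rewrite !mulr_ge0 ?ltW.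
have ds_ge0 : 0 <= delta * s n by rewrite mulr_ge0 ?ltW.
have [K_ge K_le] : delta * s n <= (K n)%:R /\ (K n)%:R <= delta * s n + 1.
  rewrite /K -natr1; have := truncn_itv ds_ge0; rewrite -natr1 => /andP[].
  by set m := _%:R; lra.
have [k_ge k_le] : L%:R * (c * s n) <= (k n)%:R /\
    (k n)%:R <= L%:R * (c * s n) + 1.
  rewrite /k -natr1; have := truncn_itv cs_ge0; rewrite -natr1 => /andP[].
  by set m := _%:R; lra.
have sizes : 1 <= c * s n ->
    [/\ (k n)%:R <= 2 * (L%:R * (c * s n)), 2 <= (k n)%:R :> R,
        4 * (k n)%:R <= (K n)%:R :> R & 1 <= delta * s n].
  move=> cs_ge1; have Lcs_ge1 : 1 <= L%:R * (c * s n) by rewrite mulr_ege1.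
  have Lcs_le : 8 * (L%:R * (c * s n)) <= delta * s n.
    by have := ler_wpM2r (ltW s_gt0) c_le1; lra.
  have k2 : 2 <= (k n)%:R :> R by rewrite ler_nat ltnS truncn_gt0.
  by split=> //; lra.
split; last first.
  move=> h [law_gt0 hV]; split=> // cs_ge1.
  have [_ _ kK _] := sizes cs_ge1; have [h_flanked h_osc] := hV cs_ge1.
  exists (k n); split=> //.
    apply: flankedW h_flanked; rewrite lez_nat -(ler_nat R).
    by have := ler0n R (k n); lra.
  by move=> j jk; apply: le_trans (oscillation_ge n h jk) h_osc.
set V := [set h | _].
suff VC_le : (mass (law p n.+1) (~` V) <= eps%:E)%E.
  have := mass_law F p_gt0 p_lt n.+1.
  rewrite /mass (esumID V) => [|h _]; last first.
    by rewrite lee_fin (law_ge0 p_gt0 p_lt).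
  rewrite !setTI => mass1; rewrite EFinB leeBlDr// -mass1.
  by rewrite leeD2l.
apply/mass_leP => D D_uniq DV.
have [cs_lt1|cs_ge1] := ltP (c * s n) 1.
  rewrite big_seq big1 ?ltW// => h /DV /=; rewrite /V /= => hV.
  have := law_ge0 p_gt0 p_lt n.+1 h; rewrite le_eqVlt => /predU1P[//|law_gt0].
  by case: hV; split=> // cs_ge1; move: cs_lt1; rewrite ltNge cs_ge1.
have [k_le2 k_ge2 kK ds_ge1] := sizes cs_ge1.
rewrite (bigID (fun h => `[< flanked (K n)%:Z h >])) /=.
have -> : eps = eps / 2 + eps / 2 by lra.
apply: lerD; last first.
  have far_le := @law_not_flanked F R p p_gt0 p_lt n.+1 (K n).
  rewrite -big_filter.
  apply: le_trans (far_le _ (filter_uniq _ D_uniq) _) _ => [h|].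
    by rewrite mem_filter => /andP[/asboolP].
  have := sgn_heat_1 p_gt0 p_lt n; rewrite -/(s n) -/C1 => s1.
  have s1_ge0 : 0 <= sgn_heat p n.+1 1 by apply: sgn_heat_ge0.
  have K2 : 2 * (K n + 2)%:R <= 8 * delta * s n by rewrite natrD; lra.
  apply: le_trans (ler_wpM2r s1_ge0 K2) _.
  have -> : eps / 2 = 8 * delta * C1.
    have C16_gt0 : 0 < 16 * C1 by apply: mulr_gt0.
    have := mulfVK (_ : 16 * C1 != 0) eps; rewrite gt_eqF// => /(_ isT).
    by rewrite -/delta; lra.
  have d8_ge0 : 0 <= 8 * delta by apply: mulr_ge0 => //; exact: ltW.
  by have := ler_wpM2l d8_ge0 s1; lra.
pose D1 := [seq h <- D | `[< flanked (K n)%:Z h >]].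
have D1_flanked h : h \in D1 -> flanked (K n)%:Z h.
  by rewrite mem_filter => /andP[/asboolP].
rewrite -big_filter -/D1.
(* An element of [D] that is flanked lies outside [V] either because its mass
   is [0] or because its oscillation is too large. *)
have osc_le h : h \in D1 -> law p n.+1 h <= eps^-1 * oscillation (k n) n h.
  move=> hD1; rewrite mulrC ler_pdivlMr// mulrC.
  rewrite leNgt; apply/negP => osc_lt.
  have law_gt0 : 0 < law p n.+1 h.
    rewrite -(pmulr_rgt0 _ eps_gt0); apply: le_lt_trans osc_lt.
    by apply: sumr_ge0 => i _.
  have : h \in D by move: hD1; rewrite mem_filter => /andP[].
  by move=> /DV; apply; split=> // _; split; [exact: D1_flanked|exact: ltW].
have kKn : ((k n).+1 < K n)%N by rewrite -(ltr_nat R) -natr1; lra.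
have := oscC (K n) (k n) n D1 kKn (filter_uniq _ D_uniq) D1_flanked.
rewrite -/(s n) => osc_sum.
apply: (@le_trans _ _ (eps^-1 * \sum_(h <- D1) oscillation (k n) n h)).
  by rewrite mulr_sumr big_seq [leRHS]big_seq ler_sum.
rewrite mulrC ler_pdivrMr//; apply: le_trans osc_sum _.
have Kk : delta * s n / 2 <= (K n - k n)%:R.
  by rewrite (natrB _ (ltnW (ltnW kKn))); lra.
have KkV : (K n - k n)%:R^-1 <= 2 / delta / s n.
  have -> : 2 / delta / s n = (delta * s n / 2)^-1.
    by rewrite !invfM invrK; lra.
  have ds2_gt0 : 0 < delta * s n / 2 by apply: divr_gt0 => //; exact: mulr_gt0.
  by rewrite lef_pV2 ?posrE// (lt_le_trans ds2_gt0).
have grad_le : C / s n + C / (K n - k n)%:R <= C2 / s n.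
  have -> : C2 / s n = C / s n + C * (2 / delta / s n) by rewrite /C2; lra.
  by rewrite lerD2l ler_wpM2l ?(ltW C_gt0).
have grad_ge0 : 0 <= C2 / s n by rewrite divr_ge0 ?ltW.
apply: (@le_trans _ _ ((2 * k n)%:R * (C2 / s n))).
  by rewrite ler_wpM2l.
apply: (@le_trans _ _ (2 * (2 * (L%:R * (c * s n))) * (C2 / s n))).
  rewrite natrM.
  by rewrite ler_wpM2r// ler_wpM2l.
have -> : 2 * (2 * (L%:R * (c * s n))) * (C2 / s n) = 4 * L%:R * C2 * c.
  have := mulfVK (_ : s n != 0) (4 * L%:R * C2 * c).
  by rewrite gt_eqF// => /(_ isT); lra.
by move: c_le2; lra.
Qed.

End Typical.

(** * Word balls *)

Section WordBalls.
Variable F : finGroupType.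
Implicit Types g h : wreath Zgrp F.

Definition extent_le (m : nat) g :=
  `|pos g| <= m%:Z /\ forall z, lamps g z != 1%g -> `|z| <= m%:Z.

Lemma extent_le1 m : extent_le m 1%g.
Proof. by split=> // z; rewrite fsfun0E eqxx. Qed.

Lemma extent_leW m m' g : (m <= m')%N -> extent_le m g -> extent_le m' g.
Proof. by move=> mm' [pg lg]; split=> [|z /lg]; lia. Qed.

Lemma extent_leM m m' g g' : extent_le m g -> extent_le m' g' ->
  extent_le (m + m') (g * g')%g.
Proof.
move=> [pg lg] [pg' lg']; split; first by rewrite pos_mul; lia.
move=> z; rewrite lamps_mul.
have [->|/lg] := eqVneq (lamps g z) 1%g; last by lia.
by rewrite mul1g => /lg'; lia.
Qed.

Lemma extent_exists g : exists m, extent_le m g /\ extent_le m g^-1%g.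
Proof.
have ex_le (f : wreath Zgrp F) : exists m, extent_le m f.
  exists (`|pos f|%N + \sum_(z <- finsupp (lamps f)) `|z : int|%N)%N.
  split=> [|z]; first by lia.
  by rewrite -mem_finsupp => z_supp; rewrite (big_rem z)//=; lia.
have [m gm] := ex_le g; have [m' gm'] := ex_le g^-1%g.
exists (m + m')%N; split.
  by apply: extent_leW gm; exact: leq_addr.
by apply: extent_leW gm'; exact: leq_addl.
Qed.

Lemma finite_extent (S : set (wreath Zgrp F)) : finite_set S ->
  exists2 L : nat, (0 < L)%N &
    forall s, S s \/ S s^-1%g -> extent_le L s.
Proof.
move=> /finite_seqP[r ->].
elim: r => [|g r [L L_gt0 IH]]; first by exists 1%N => // s [].
have [m [gm gVm]] := extent_exists g.
exists (L + m)%N; first by rewrite addn_gt0 L_gt0.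
move=> s; rewrite /= !inE => -[/orP[/eqP->|sr]|/orP[/eqP sg|sr]].
- by apply: extent_leW gm; exact: leq_addl.
- by apply: extent_leW (leq_addr _ _) (IH s _); left.
- by rewrite -[s]invgK sg; apply: extent_leW gVm; exact: leq_addl.
- by apply: extent_leW (leq_addr _ _) (IH s _); right.
Qed.

Lemma word_ball_word (R : realType) (S : set (wreath Zgrp F)) (r : R) g :
  0 <= r -> word_ball S 1%g r g -> exists2 w, words S g w & (size w)%:R <= r.
Proof.
move=> r_ge0; rewrite /word_ball /word_dist /= invg1 mul1g => ball_g.
have r_lt : (r%:E < (Num.truncn r).+1%:R%:E)%E by rewrite lte_fin truncnS_gt.
have /ereal_inf_lt[_ [w gw <-]] := le_lt_trans ball_g r_lt.
rewrite lte_fin ltr_nat ltnS => w_le.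
by exists w => //; rewrite -truncn_ge_nat.
Qed.

End WordBalls.

Lemma extent_word (F : finGroupType) (S : set (wreath Zgrp F)) (L : nat) g w :
  (forall s, S s \/ S s^-1%g -> extent_le L s) -> words S g w ->
  extent_le (L * size w) g.
Proof.
move=> SL [wS <-]; elim: w wS => [|s w IH] wS.
  by rewrite big_nil muln0; exact: extent_le1.
rewrite big_cons /= mulnS; apply: extent_leM.
  by apply/SL/wS; rewrite mem_head.
by apply: IH => t tw; apply: wS; rewrite inE tw orbT.
Qed.

Theorem theorem1p3 (R : realType) (F : finGroupType)
    (mu : wreath Zgrp F -> R) (S : set (wreath Zgrp F)) :
  is_prob mu ->
  switch_walk_switch mu ->
  finite_set S ->
  generates S ->
  (forall eps : R, 0 < eps ->
     exists (c : R) (V : nat -> set (wreath Zgrp F)),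
       [/\ 0 < c,
           (forall n, (0 < n)%N ->
              ((1 - eps)%:E <= mass (convol_pow mu n) (V n))%E) &
           forall n h, (0 < n)%N -> V n h ->
             0 < convol_pow mu n h /\
             forall g, word_ball S 1%g (c * Num.sqrt n%:R) g ->
               `|convol_pow mu n (h * g)%g / convol_pow mu n h - 1| <= eps])
  /\
  (forall eps : R, 0 < eps ->
     exists (c : R) (V : nat -> set (wreath Zgrp F)),
       [/\ 0 < c,
           (forall n, (0 < n)%N ->
              ((1 - eps)%:E <= mass (convol_pow mu n) (V n))%E) &
           forall n h, (0 < n)%N -> V n h ->
             forall g,
               (word_ball S 1%g (c * Num.sqrt n%:R) `&`
                @lamp_subgroup Zgrp F) g ->
               convol_pow mu n (h * g)%g = convol_pow mu n h]).
Proof.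
move=> _ /switch_walk_switch_weights[p [p_gt0 p_lt] ->] S_fin _.
have [L L_gt0 SL] := finite_extent S_fin.
(* One sequence of sets serves both parts. *)
suff main (eps : R) : 0 < eps ->
    exists2 c : R, 0 < c & exists V : nat -> set (wreath Zgrp F), forall n,
    ((1 - eps)%:E <= mass (law p n.+1) (V n))%E /\
    forall h, V n h -> 0 < law p n.+1 h /\
    forall g, word_ball S 1%g (c * Num.sqrt n.+1%:R) g ->
      `|law p n.+1 (h * g)%g - law p n.+1 h| <= eps * law p n.+1 h /\
      (pos g = 0 -> law p n.+1 (h * g)%g = law p n.+1 h).
  split=> eps /main[c c_gt0 [V cV]]; exists c, (fun n => V n.-1).
    split=> // [[|n] // _|[|n] // h _ hV]; first by have [] := cV n.
    have [_ /(_ h hV)[law_gt0 law_g]] := cV n; split=> // g /law_g[law_le _].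
    rewrite -[X in _ - X](divff (lt0r_neq0 law_gt0)) -mulrBl normrM.
    by rewrite [X in _ * X]gtr0_norm ?invr_gt0// ler_pdivrMr.
  split=> // [[|n] // _|[|n] // h _ hV g [/= gB g0]]; first by have [] := cV n.
  have [_ /(_ h hV)[_ law_g]] := cV n.
  by have [_] := law_g g gB; apply.
move=> eps_gt0; have [c c_gt0 [V cV]] := typical_set F p_gt0 p_lt eps_gt0 L_gt0.
exists c => //; exists V => n; have [V_mass hV] := cV n; split=> // h Vh.
have [law_gt0 h_typical] := hV h Vh; split=> // g g_ball.
have cs_ge0 : 0 <= c * Num.sqrt n.+1%:R by rewrite mulr_ge0 ?ltW// sqrtr_ge0.
have [w gw w_le] := word_ball_word cs_ge0 g_ball.
have [cs_lt1|cs_ge1] := ltP (c * Num.sqrt n.+1%:R) 1.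
  have w_nil : w = [::].
    apply: size0nil; have := le_lt_trans w_le cs_lt1.
    by rewrite ltrn1; case: size.
  have -> : g = 1%g by case: gw => _ <-; rewrite w_nil big_nil.
  by rewrite mulg1 subrr normr0; split=> //; rewrite mulr_ge0 ?ltW.
have [k [k_ge h_flanked h_close]] := h_typical cs_ge1.
have wk : (L * size w <= k)%N.
  by rewrite -(ler_nat R) natrM (le_trans _ k_ge)// ler_wpM2l.
have [pg lg] := extent_leW wk (extent_word SL gw).
have -> : law p n.+1 (h * g)%g = law p n.+1 (walk h (pos g)).
  apply: (law_flanked p_gt0 p_lt n h_flanked) => [|z z_far].
    exact: pos_mul.
  rewrite lamps_mul; have [->|/lg] := eqVneq (lamps g (z - pos h)) 1%g.
    by rewrite mulg1.
  by rewrite leNgt z_far.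
split; first exact: h_close.
by move=> ->; rewrite walk0.
Qed.
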